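(* Let $B$ be a connected bipartite graph with bipartition $V=\{v_1,\dots,v_n\}\cup\{w_1,\dots,w_d\}$, where $n,d\ge2$. Let $r=|\{v_i:\deg(v_i)=1\}|$ and $s=|\{w_j:\deg(w_j)=1\}|$. Then $$\mathrm{reg}(\Bbbk[B])\le\min\{n-r,\,d-s\}-1.$$
   Context: Let $\Bbbk$ be a field. For a finite simple graph $G$ with vertex set $V$ and edge set $E$, the toric edge ring $\Bbbk[G]$ is the $\Bbbk$-subalgebra of the polynomial ring $\Bbbk[V]$ generated by the monomials $uv$ with $\{u,v\}\in E$. The toric edge ideal $J_G$ is the kernel of the map $\Bbbk[E]\to\Bbbk[V]$ sending the variable of $e=\{u,v\}$ to $uv$, so $\Bbbk[G]\cong\Bbbk[E]/J_G$. $\mathrm{reg}(\Bbbk[G])$ is the Castelnuovo–Mumford regularity of $\Bbbk[G]$ as a graded $\Bbbk[E]$-module (standard grading): $\max\{j:\beta_{i,i+j}\neq0\text{ for some }i\}$. *)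

(* Defs.v *)
From HB Require Import structures.
From mathcomp Require Import all_boot all_order all_algebra.
From mathcomp Require Export mpoly.

Set Implicit Arguments.
Unset Strict Implicit.
Unset Printing Implicit Defensive.

Import GRing.Theory.
Local Open Scope ring_scope.

Record sgraph := SGraph {
  vertex :> finType;
  adj : rel vertex;
  adj_sym : ssrbool.symmetric adj;
  adj_irr : irreflexive adj
}.

Section Graphs.
Variable G : sgraph.

Definition edges : {set {set G}} :=
  [set [set p.1; p.2] | p : G * G & adj p.1 p.2].

Definition degree (v : G) : nat := #|[set u | adj v u]|.

Definition connected_graph : Prop := forall u v : G, connect (@adj G) u v.

Definition bipartition (V W : {set G}) : Prop :=
  [/\ V :|: W = setT, [disjoint V & W]
    & forall u v : G, adj u v -> (u \in V) = (v \in W)].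

Definition leaves (A : {set G}) : {set G} := [set v in A | degree v == 1%N].

End Graphs.

(* The variables of k[V] are indexed by 'I_#|G| through enum_rank, those of
   k[E] by 'I_#|edges G| through enum_val. *)
Section ToricEdgeIdeal.
Variables (k : fieldType) (G : sgraph).

Definition edge_monomial (e : {set G}) : {mpoly k[#|G|]} :=
  \prod_(v in e) 'X_(enum_rank v).

Definition toric_map (p : {mpoly k[#|edges G|]}) : {mpoly k[#|G|]} :=
  p \mPo [tuple edge_monomial (enum_val a) | a < #|edges G|].

Definition toric_edge_ideal : {pred {mpoly k[#|edges G|]}} :=
  [pred p | toric_map p == 0].

End ToricEdgeIdeal.

Arguments toric_edge_ideal k G : clear implicits.

Section Regularity.
Variables (k : fieldType) (m : nat).
Local Notation S := {mpoly k[m]}.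

(* An augmented sequence of finitely generated graded free modules
     ... -> F_1 -> F_0 -> S,  F_i = \bigoplus_(a < rk i) S(- shift a).
   Elements of F_i are row vectors, so that maps act by right multiplication;
   the augmentation lists representatives in S of the images of the basis of
   F_0 in a quotient of S.  Shifts in nat lose nothing here: in a minimal
   resolution of a quotient of S no generator has negative degree. *)
Record free_complex := FreeComplex {
  rk : nat -> nat;
  shift : forall i, 'I_(rk i) -> nat;
  diff : forall i, 'M[S]_(rk i.+1, rk i);
  aug : 'cV[S]_(rk 0)
}.

(* Stated additively, this forces an entry to vanish when its source
   generator has smaller degree than its target generator. *)
Definition degree_preserving (F : free_complex) : Prop :=
  (forall b mon, mon \in msupp (aug F b 0) -> mdeg mon = shift b) /\
  (forall i a b mon, mon \in msupp (diff F i a b) ->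
     (mdeg mon + shift b)%N = shift a).

Definition resolves_quotient (I : {pred S}) (F : free_complex) : Prop :=
  [/\ forall p : S, exists u : 'rV[S]_(rk F 0), p - (u *m aug F) 0 0 \in I,
      forall u : 'rV[S]_(rk F 0),
        (u *m aug F) 0 0 \in I <-> exists w, u = w *m diff F 0
    & forall i (u : 'rV[S]_(rk F i.+1)),
        u *m diff F i = 0 <-> exists w, u = w *m diff F i.+1].

(* The image of each differential lies in (x_1, ..., x_m) F_i. *)
Definition minimal_complex (F : free_complex) : Prop :=
  forall i a b, (diff F i a b)@_0%MM = 0.

Definition minimal_graded_free_resolution (I : {pred S}) (F : free_complex) :=
  [/\ degree_preserving F, resolves_quotient I F & minimal_complex F].

Definition betti (F : free_complex) (i j : nat) : nat :=
  #|[set a : 'I_(rk F i) | shift a == j]|.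

(* rho is the regularity of S/I, for a homogeneous ideal I.  Minimal graded
   free resolutions exist and are unique up to isomorphism, so rho exists and
   is unique when I is proper. *)
Definition is_regularity (I : {pred S}) (rho : nat) : Prop :=
  exists F, [/\ minimal_graded_free_resolution I F,
    exists i, betti F i (i + rho) != 0%N
  & forall i j, betti F i (i + j) != 0%N -> (j <= rho)%N].

End Regularity.

(* Main.v *)
Require Import Defs.
From HB Require Import structures.
From mathcomp Require Import all_boot all_order all_algebra.
From Stdlib Require Import Classical ClassicalEpsilon.
From mathcomp Require Import ring zify.

(** It suffices to show that the regularity [rho] is less than the number of
   non-leaves in [V], the other bound following by exchanging the two sides.
   A basis element of degree [i + rho] in the [i]-th module of a minimal
   resolution forces the Koszul homology of the edge ring to be nonzero in
   homological degree [i] and internal degree [i + rho]: this is the balancing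
   of Tor, carried out by a zigzag in the double complex of the Koszul complex
   and the resolution ([zigzag], [no_generator]).  Since the edge ring is
   spanned by monomials, its Koszul complex splits into the chain complexes of
   the divisor complexes: the faces for a multidegree [b] are the edge sets [F]
   such that [b] minus the degrees of [F] is the degree sequence of a multigraph
   on the edges of the graph ([koszul_exact_of_strands]).  What has to be shown
   is that the divisor complex of [b] has no homology on faces with [i] elements
   as soon as the total [N] of [b] over [W], minus [i], is at least the number
   of non-leaves in [V] ([divisor_acyclic]).

   To that end every degree sequence [c] is represented by a canonical flow: the
   lexicographically least nonnegative rational flow whose degrees are [c] plus
   a small multiple [eps] of the degrees of the graph.  This is modelled on the
   standard monomials of a unimodular triangulation of the edge polytope, and on
   the half-open decomposition of that triangulation given by the perturbation.
   The value of a face [F] is the canonical flow of what remains of [b], plus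
   one unit on each edge of [F].  Removing an edge from [F] cannot raise the
   value, because the old flow plus one unit is a competitor for the new
   degrees; and if some edge has value above one, then it can be added to or
   removed from any face of the same value without changing the value
   ([lexmin_add], [lexmin_sub]).  So the leading part of a cycle is the leading
   part of a boundary, and the cycle is a boundary by induction
   ([acyclic_of_toggle]).

   There remain the faces [F] with all values at most one.  The support of the
   canonical flow is a forest and has fewer edges than the graph has vertices
   ([card_forest]).  On the other hand, with [c] the remaining degrees, edges at
   leaves of [V] carry exactly [eps], and at a vertex [w] of [W] the other
   edges carry more than [c w] in total, so more than [c w] of them are in the
   support ([support_count]).  Hence the sum of [c w + 1] over [W], plus the
   number of leaves in [V], is at most the number of vertices minus one, that
   is, the total of [c] over [W] is less than the number of non-leaves in [V],
   which the assumption on [b] excludes when [F] has [i] elements. *)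

Set Implicit Arguments.
Unset Strict Implicit.
Unset Printing Implicit Defensive.

Import Order.TTheory GRing.Theory Num.Theory.
Local Open Scope ring_scope.

(** * Koszul boundaries *)

Section KoszulBoundary.
Variable m : nat.
Implicit Types (e : 'I_m) (A : {set 'I_m}).

Definition inversions e A : nat := #|[set j in A | (j < e)%N]|.

(** A chain on all subsets at once, the homological degree being the
   cardinality of the subset; [z A] is the coefficient of the wedge of [A]. *)
Definition koszul_bd (R : comNzRingType) (V : lmodType R) (x : 'I_m -> R)
    (z : {set 'I_m} -> V) A : V :=
  \sum_(e | e \notin A) ((-1) ^+ inversions e A * x e) *: z (e |: A).

Lemma inversionsU e e' A : e' \notin A ->
  inversions e (e' |: A) = (inversions e A + (e' < e))%N.
Proof.
move=> e'A; rewrite /inversions; case: ltnP => [lt_e'e|le_ee'].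
  have -> : [set j in e' |: A | (j < e)%N] = e' |: [set j in A | (j < e)%N].
    by apply/setP=> j; rewrite !inE; case: eqVneq => // ->; rewrite lt_e'e.
  by rewrite cardsU1 !inE (negPf e'A) addnC.
rewrite addn0; apply: eq_card => j; rewrite !inE.
by case: eqVneq => // ->; rewrite ltnNge le_ee' ?andbF.
Qed.

Lemma koszul_signs (R : comNzRingType) e e' A :
    e != e' -> e \notin A -> e' \notin A ->
  (-1) ^+ inversions e A * (-1) ^+ inversions e' (e |: A) =
    - ((-1) ^+ inversions e' A * (-1) ^+ inversions e (e' |: A)) :> R.
Proof.
move=> ne eA e'A; rewrite !inversionsU // !exprD.
have [lt|gt|/val_inj eq] := ltngtP e e'; last by rewrite eq eqxx in ne.
  by rewrite expr1 expr0; ring.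
by rewrite expr1 expr0; ring.
Qed.

Lemma sum_antisym0 (V : zmodType) (P : rel 'I_m) (F : 'I_m -> 'I_m -> V) :
    (forall i j, P i j -> P j i) -> irreflexive P ->
    (forall i j, P i j -> F i j = - F j i) ->
  \sum_i \sum_(j | P i j) F i j = 0.
Proof.
move=> Psym Pirr Fanti; rewrite pair_big_dep /=.
rewrite (bigID (fun p : 'I_m * 'I_m => (p.1 < p.2)%N)) /=.
rewrite [X in _ + X](reindex_inj (h := fun p => (p.2, p.1))) /=; last first.
  by move=> [? ?] [? ?] [-> ->].
rewrite [X in _ + X](eq_bigl (fun p => P p.1 p.2 && (p.1 < p.2)%N)); last first.
  move=> [i j] /=; apply/andP/andP => -[Pij].
    rewrite -leqNgt leq_eqVlt => /orP[/eqP/val_inj eq|->]; last by rewrite Psym.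
    by rewrite eq Pirr in Pij.
  by move=> lt; rewrite Psym // -leqNgt ltnW.
rewrite -big_split big1 //= => -[i j] /= /andP[Pij _].
by rewrite Fanti // addNr.
Qed.

Lemma koszul_bd_bd (R : comNzRingType) (V : lmodType R) (x : 'I_m -> R)
  (z : {set 'I_m} -> V) A : koszul_bd x (koszul_bd x z) A = 0.
Proof.
rewrite /koszul_bd.
under eq_bigr => e _ do rewrite scaler_sumr.
rewrite big_mkcond /=.
pose P e e' := [&& e \notin A, e' \notin A & e != e'].
pose F e e' := (((-1) ^+ inversions e A * x e) *
  ((-1) ^+ inversions e' (e |: A) * x e')) *: z (e' |: (e |: A)).
rewrite (eq_bigr (fun e => \sum_(e' | P e e') F e e')) => [|e _].
  apply: sum_antisym0 => [i j|i|i j].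
  - by rewrite /P eq_sym => /and3P[-> -> ->].
  - by rewrite /P eqxx !andbF.
  case/and3P=> iA jA ne; rewrite /F (setUCA [set j]) -scaleNr; congr (_ *: _).
  have := koszul_signs R ne iA jA.
  set a := _ ^+ _; set b := _ ^+ _; set c := _ ^+ _; set d := _ ^+ _ => E.
  transitivity (a * b * (x i * x j)); first by ring.
  by rewrite E; ring.
case: ifP => eA; last first.
  by rewrite big_pred0 // => e'; rewrite /P eA.
apply: eq_big => [e'|e' _]; last by rewrite scalerA.
by rewrite /P eA !inE negb_or eq_sym andbC.
Qed.

Lemma koszul_bdB (R : comNzRingType) (V : lmodType R) (x : 'I_m -> R)
  (z z' : {set 'I_m} -> V) A :
  koszul_bd x (fun B => z B - z' B) A = koszul_bd x z A - koszul_bd x z' A.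
Proof.
by rewrite /koszul_bd -sumrB; apply: eq_bigr => e _; rewrite scalerBr.
Qed.

Lemma eq_koszul_bd (R : comNzRingType) (V : lmodType R) (x : 'I_m -> R)
  (z z' : {set 'I_m} -> V) : z =1 z' -> koszul_bd x z =1 koszul_bd x z'.
Proof. by move=> eqz A; apply: eq_bigr => e _; rewrite eqz. Qed.

End KoszulBoundary.

(** * Acyclicity of simplicial complexes by leading values *)

Section LeadingValues.
Variables (k : fieldType) (m : nat).
Implicit Types (e : 'I_m) (A B C : {set 'I_m}).

(** For a simplicial complex [D], vanishing of the reduced homology in dimension
   [p - 1]; the empty face counts, so the case [p = 0] says that [D] has a
   vertex if it has a face. *)
Definition acyclic_at (D : pred {set 'I_m}) (p : nat) : Prop :=
  forall z : {set 'I_m} -> k^o,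
    (forall A, z A != 0 -> D A /\ #|A| = p) ->
    koszul_bd (fun=> 1 : k) z =1 (fun=> 0) ->
  exists2 y : {set 'I_m} -> k^o,
    forall A, y A != 0 -> D A /\ #|A| = p.+1 & z =1 koszul_bd (fun=> 1 : k) y.

(** The faces are filtered by a value that does not increase along the
   boundary.  In the associated graded complex the faces of equal value [v] are
   matched by adding and removing a vertex [e] with [T v e], so the leading part
   of a cycle is the leading part of a boundary, and subtracting that boundary
   lowers the leading value. *)
Lemma acyclic_of_toggle (disp : Order.disp_t) (L : orderType disp)
    (D : pred {set 'I_m}) (p : nat) (val : {set 'I_m} -> L)
    (T : L -> 'I_m -> bool) :
    (forall e A, D (e |: A) -> D A) ->
    (forall e A, e \notin A -> D (e |: A) -> (val A <= val (e |: A))%O) ->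
    (forall e A, D A -> T (val A) e ->
       [/\ D (e |: A), val (e |: A) = val A & val (A :\ e) = val A]) ->
    (forall A, D A -> #|A| = p -> exists e, T (val A) e) ->
  acyclic_at D p.
Proof.
move=> Ddown valmono toggle hasT z.
pose lower (z : {set 'I_m} -> k^o) :=
  [set A | [exists B, (z B != 0) && (val A <= val B)%O]].
have [n] := ubnP #|lower z|; elim: n => // n IHn in z *.
rewrite ltnS => le_n zD z0.
have [B0 zB0|z_0] := pickP (fun A => z A != 0); last first.
  exists (fun=> 0) => [A|A]; first by rewrite eqxx.
  rewrite /koszul_bd big1 => [|e _]; last by rewrite scaler0.
  by apply/eqP; move/negbFE: (z_0 A).
have [B zB maxB] : exists2 B, z B != 0
    & forall A, z A != 0 -> (val A <= val B)%O.
  by case: (@arg_maxP _ _ _ B0 (fun A => z A != 0) val zB0) => B ? ?; exists B.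
have [DB cardB] := zD _ zB; have [e0 Te0] := hasT _ DB cardB.
set v := val B in Te0 maxB.
have togv A : D A -> val A = v ->
    [/\ D (e0 |: A), val (e0 |: A) = v & val (A :\ e0) = v].
  by move=> DA vA; rewrite -vA; apply: toggle; rewrite ?vA.
(* Half of the matching: [e0] is added to the faces of leading value. *)
pose y A : k^o := if [&& e0 \in A, D A & val A == v]
  then (-1) ^+ inversions e0 (A :\ e0) *: z (A :\ e0) else 0.
have ynz A : y A != 0 -> [/\ e0 \in A, D A, val A = v & z (A :\ e0) != 0].
  rewrite /y; case: ifP => [/and3P[-> -> /eqP->] ynz|_]; last by rewrite eqxx.
  by split=> //; apply: contraNneq ynz => ->; rewrite scaler0.
have yD A : y A != 0 -> D A /\ #|A| = p.+1.
  by move=> /ynz[e0A DA _ /zD[_ cA]]; split; rewrite // (cardsD1 e0) e0A cA.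
have bdy_nz A : koszul_bd (fun=> 1 : k) y A != 0 ->
    [/\ D A, #|A| = p & (val A <= v)%O].
  move=> nz; have [e /andP[eA ye]|none] :=
    pickP (fun e => (e \notin A) && (y (e |: A) != 0)); last first.
    case/eqP: nz; rewrite /koszul_bd big1 // => e eA.
    by have /negbT := none e; rewrite eA /= negbK => /eqP->; rewrite scaler0.
  have [_ DeA veA _] := ynz _ ye; have [_] := yD _ ye.
  rewrite cardsU1 eA => -[cA]; split=> //; first exact: Ddown DeA.
  by rewrite -veA valmono.
(* If [e0] is not in [A], only the term adding [e0] survives; if it is, the
   cycle condition at [A] minus [e0] expresses [z A] by the other terms, in which
   only faces of leading value occur because values do not increase along the
   boundary. *)
have bdy_lead A : D A -> val A = v -> koszul_bd (fun=> 1 : k) y A = z A.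
  move=> DA vA; have [De ve vD] := togv A DA vA.
  have [e0A|e0A] := boolP (e0 \in A); last first.
    rewrite /koszul_bd (bigD1 e0) //= big1 ?addr0 => [|e /andP[eA ne]].
      rewrite /y De ve eqxx setU11 /= mulr1 setU1K // scalerA -exprD.
      by rewrite -signr_odd oddD addbb scale1r.
    by rewrite /y !inE (negPf e0A) orbF eq_sym (negPf ne) scaler0.
  set A' := A :\ e0; have e0A' : e0 \notin A' by rewrite !inE eqxx.
  have AE : A = e0 |: A' by rewrite setD1K.
  have eAE e : (e \notin A) = (e \notin A') && (e != e0).
    by rewrite [in LHS]AE in_setU1 negb_or andbC.
  have := z0 A'; rewrite /koszul_bd (bigD1 e0) //= -AE mulr1.
  move/eqP; rewrite addr_eq0 => /eqP zAE.
  have -> : z A = (-1) ^+ inversions e0 A' *: ((-1) ^+ inversions e0 A' *: z A).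
    by rewrite scalerA -exprD -signr_odd oddD addbb scale1r.
  rewrite zAE scalerN scaler_sumr -sumrN; apply: eq_big => [e|e eA].
    by rewrite eAE.
  have [eA' ne] : e \notin A' /\ e != e0.
    by move: eA; rewrite eAE => /andP.
  have eAD : (e |: A) :\ e0 = e |: A'.
    by apply/setP=> i; rewrite !inE; case: (eqVneq i e) => // ->; rewrite ne.
  have -> : y (e |: A) = (-1) ^+ inversions e0 (e |: A') *: z (e |: A').
    rewrite /y eAD !inE e0A orbT /=; case: ifP => // /negbT nD.
    have [->|zne] := eqVneq (z (e |: A')) 0; first by rewrite scaler0.
    have [DeA' _] := zD _ zne.
    have veA' : val (e |: A') = v.
      apply: le_anti; rewrite maxB //= -vD; exact: valmono.
    have [] := togv _ DeA' veA'; rewrite setUCA -AE => DeA veA _.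
    by rewrite DeA veA eqxx in nD.
  have iA : inversions e A = (inversions e A' + (e0 < e))%N.
    by rewrite AE inversionsU.
  rewrite !mulr1 !scalerA -scaleNr iA inversionsU // !exprD; congr (_ *: _).
  have [lt|gt|/val_inj eq] := ltngtP e0 e; last by rewrite eq eqxx in ne.
    by rewrite expr1 expr0; ring.
  by rewrite expr1 expr0; ring.
pose z' A := z A - koszul_bd (fun=> 1 : k) y A.
have z'v A : z' A != 0 -> [/\ D A, #|A| = p, (val A <= v)%O & val A != v].
  rewrite /z' => nz.
  have [DA cA leA] : [/\ D A, #|A| = p & (val A <= v)%O].
    have [zA|zA] := eqVneq (z A) 0; last by have [? ?] := zD _ zA; rewrite maxB.
    by apply: bdy_nz; rewrite zA sub0r oppr_eq0 in nz.
  by split=> //; apply: contraNneq nz => vA; rewrite bdy_lead ?subrr.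
have [|A /z'v[? ? _ _]||y' y'D z'E] := IHn z'; rewrite //.
- apply: leq_trans le_n; apply: proper_card; apply/properP; split.
    apply/subsetP=> A; rewrite !inE => /existsP[C /andP[/z'v[_ _ le _] le']].
    by apply/existsP; exists B; rewrite zB (le_trans le').
  exists B; first by rewrite inE; apply/existsP; exists B; rewrite zB lexx.
  rewrite inE; apply/existsP=> -[C /andP[/z'v[_ _ le ne] le']].
  by case/eqP: ne; apply: le_anti; rewrite le.
- by move=> A; rewrite /z' koszul_bdB z0 koszul_bd_bd subrr.
exists (fun A => y' A + y A) => [A nz|A].
  have [y'0|/y'D//] := eqVneq (y' A) 0.
  by apply: yD; rewrite y'0 add0r in nz.
transitivity (z' A + koszul_bd (fun=> 1 : k) y A); first by rewrite subrK.
rewrite z'E /koszul_bd -big_split; apply: eq_bigr => e _.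
by rewrite scalerDr.
Qed.

End LeadingValues.

(** * Koszul complexes of monomial algebras *)

Section MonomialKoszul.
Variables (k : fieldType) (l m : nat) (mon : 'I_m -> 'X_{1..l}).
Implicit Types (e : 'I_m) (A B : {set 'I_m}) (b c : 'X_{1..l}).
Implicit Types (z y : {set 'I_m} -> {mpoly k[l]}^o).

Definition mon_sum A : 'X_{1..l} := (\sum_(e in A) mon e)%MM.

Definition koszul_var e : {mpoly k[l]} := 'X_[mon e].

(** The multidegree of the wedge of [A] is [mon_sum A], so this is the part of
   multidegree [b] of the chain [z]. *)
Definition strand_coef z b A : k^o :=
  if (mon_sum A <= b)%MM then (z A)@_(b - mon_sum A) else 0.

Lemma mon_sumU e A : e \notin A -> mon_sum (e |: A) = (mon e + mon_sum A)%MM.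
Proof. by move=> eA; rewrite /mon_sum big_setU1. Qed.

Lemma mcoeff_sign (n : nat) (p : {mpoly k[l]}) c :
  ((-1) ^+ n * p)@_c = (-1) ^+ n * p@_c.
Proof.
rewrite -signr_odd -[in RHS]signr_odd; case: odd; last by rewrite !mul1r.
by rewrite expr1 !mulN1r mcoeffN.
Qed.

Lemma mcoeffXM (u c : 'X_{1..l}) (p : {mpoly k[l]}) :
  ('X_[u] * p)@_c = if (u <= c)%MM then p@_(c - u) else 0.
Proof.
rewrite mulrC; case: ifPn => [le_uc|nle].
  by rewrite -{1}(submK le_uc) addmC mcoeffMX.
apply: memN_msupp_eq0; rewrite (perm_mem (msuppMX _ _)).
by apply: contra nle => /mapP[c' _ ->]; apply: lem_addr.
Qed.

Lemma mcoeff_koszul_bd z A c :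
  (koszul_bd koszul_var z A)@_c =
    koszul_bd (fun=> 1 : k) (strand_coef z (c + mon_sum A)) A.
Proof.
rewrite /koszul_bd raddf_sum; apply: eq_bigr => e eA /=.
rewrite mulr1 -scalerA mcoeff_sign mcoeffXM /strand_coef mon_sumU //.
have -> : (mon e + mon_sum A <= c + mon_sum A)%MM = (mon e <= c)%MM.
  by apply/mnm_lepP/mnm_lepP => le i; have := le i; rewrite !mnmDE leq_add2r.
congr (_ * _); case: ifP => // _; congr (_@_ _).
by apply/mnmP=> i; rewrite !(mnmBE, mnmDE) subnDr.
Qed.

Variable Q : pred 'X_{1..l}.
Hypothesis Q_mul : forall e c, Q c -> Q (mon e + c)%MM.

(** The squarefree divisor complex of [b]: its faces span the part of
   multidegree [b] of the Koszul complex on the monomials [mon e] with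
   coefficients in the span of the monomials in [Q]. *)
Definition divisor_complex b A : bool :=
  (mon_sum A <= b)%MM && Q (b - mon_sum A)%MM.

Lemma divisor_complex_down b e A :
  divisor_complex b (e |: A) -> divisor_complex b A.
Proof.
have [eA|eA] := boolP (e \in A); first by rewrite (setUidPr _) ?sub1set.
rewrite /divisor_complex mon_sumU // => /andP[/mnm_lepP le Qb].
have leA : (mon_sum A <= b)%MM.
  by apply/mnm_lepP=> i; apply: leq_trans (le i); rewrite mnmDE leq_addl.
rewrite leA /=; have := Q_mul e Qb; congr (is_true (Q _)).
apply/mnmP=> i; rewrite !(mnmBE, mnmDE); have := le i; rewrite mnmDE; lia.
Qed.

(** The Koszul complex is the direct sum of its strands, and the strand of
   multidegree [b] is the chain complex of the divisor complex of [b]. *)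
Lemma koszul_exact_of_strands z (p : nat) :
    (forall A c, c \in msupp (z A) -> Q c /\ #|A| = p) ->
    koszul_bd koszul_var z =1 (fun=> 0) ->
    (forall A c, c \in msupp (z A) ->
       acyclic_at k (divisor_complex (c + mon_sum A)) p) ->
  exists2 y : {set 'I_m} -> {mpoly k[l]}^o,
    forall A c, c \in msupp (y A) ->
      [/\ Q c, #|A| = p.+1 & exists A' c',
          c' \in msupp (z A') /\ (c + mon_sum A = c' + mon_sum A')%MM]
    & z =1 koszul_bd koszul_var y.
Proof.
move=> zQ z0 acyc.
pose bs := undup (flatten
  [seq [seq (c + mon_sum A)%MM | c <- msupp (z A)] | A : {set 'I_m}]).
have bsP b : reflect (exists A c, c \in msupp (z A) /\ b = (c + mon_sum A)%MM)
    (b \in bs).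
  rewrite mem_undup; apply: (iffP flatten_mapP).
    by case=> A _ /mapP[c zc ->]; exists A, c.
  by case=> A [c [zc ->]]; exists A; [rewrite mem_enum | apply/mapP; exists c].
pose bounds b (y : {set 'I_m} -> k^o) :=
  (forall A, y A != 0 -> divisor_complex b A /\ #|A| = p.+1) /\
  strand_coef z b =1 koszul_bd (fun=> 1 : k) y.
have [Y YP] : exists Y, forall b, b \in bs -> bounds b (Y b).
  exists (fun b => epsilon (inhabits (fun=> 0)) (bounds b)) => b bbs.
  apply: epsilon_spec; case/bsP: bbs => A0 [c0 [zc0 bE]].
  have [A||y ? ?] := acyc _ _ zc0 (strand_coef z b).
  - rewrite -bE /strand_coef /divisor_complex; case: ifP; rewrite ?eqxx // => le.
    by rewrite -mcoeff_msupp => /zQ[-> ->].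
  - move=> A; have [le|nle] := boolP (mon_sum A <= b)%MM.
      by rewrite -(submK le) -mcoeff_koszul_bd z0 mcoeff0.
    rewrite /koszul_bd big1 // => e eA; rewrite /strand_coef mon_sumU //.
    case: ifP => [le|_]; last by rewrite scaler0.
    case/negP: nle; apply: lepm_trans le; exact: lem_addl.
  by exists y; split=> // A ynz; rewrite bE; auto.
pose y A : {mpoly k[l]}^o :=
  \sum_(b <- bs | (mon_sum A <= b)%MM) Y b A *: 'X_[b - mon_sum A].
have yE A c : (y A)@_c = if (c + mon_sum A)%MM \in bs
    then Y (c + mon_sum A)%MM A else 0.
  rewrite raddf_sum /=.
  rewrite (eq_bigr (fun b => if b == (c + mon_sum A)%MM then Y b A else 0)).
    rewrite big_mkcond /=; case: ifP => [bbs|/negP bbs].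
      rewrite (bigD1_seq (c + mon_sum A)%MM) ?undup_uniq //= eqxx lem_addl.
      by rewrite big1 ?addr0 // => b /negPf->; rewrite if_same.
    rewrite big_seq big1 // => b bbs'; case: ifP => // _.
    by case: eqP => // bE; rewrite -bE in bbs.
  move=> b le; rewrite mcoeffZ mcoeffX.
  have -> : (b - mon_sum A == c)%MM = (b == (c + mon_sum A)%MM).
    apply/eqP/eqP => [<-|->]; [by rewrite submK | exact: addmK].
  by case: eqP => _; rewrite ?mulr1 ?mulr0.
have yS b B : b \in bs -> strand_coef y b B = Y b B.
  move=> bbs; rewrite /strand_coef; case: ifPn => [le|nle].
    by rewrite yE submK // bbs.
  have [supp _] := YP _ bbs; apply/esym/eqP; apply: contraR nle.
  by case/supp => /andP[].
exists y => [A c|A].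
  rewrite mcoeff_msupp yE; case: ifPn => [bbs nz|_]; last by rewrite eqxx.
  have [supp _] := YP _ bbs; have [/andP[_ QA] cA] := supp _ nz.
  by rewrite addmK in QA; case/bsP: bbs => A' [c' [zc' E]]; split=> //;
    exists A', c'.
apply/mpolyP=> c; rewrite mcoeff_koszul_bd.
have zE : (z A)@_c = strand_coef z (c + mon_sum A) A.
  by rewrite /strand_coef lem_addl addmK.
have [bbs|nbs] := boolP ((c + mon_sum A)%MM \in bs).
  by rewrite zE (proj2 (YP _ bbs)); apply: eq_bigr => e _; rewrite yS.
rewrite /koszul_bd big1 => [|e _].
  apply: memN_msupp_eq0; apply: contra nbs => zc; apply/bsP; by exists A, c.
rewrite /strand_coef; case: ifP; rewrite ?scaler0 // => le.
by rewrite yE submK // (negPf nbs) scaler0.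
Qed.

End MonomialKoszul.

(** * Minimal resolutions and Koszul homology *)

Section PolynomialKoszul.
Variables (k : fieldType) (m : nat).
Local Notation S := {mpoly k[m]}.
Local Notation X := (koszul_var k (fun e : 'I_m => U_(e)%MM)).
Implicit Types (e : 'I_m) (A : {set 'I_m}).

Lemma mon_sum_varE A e : mon_sum (fun e : 'I_m => U_(e)%MM) A e = (e \in A).
Proof.
rewrite /mon_sum mnm_sumE; under eq_bigr => i _ do rewrite mnm1E.
have [eA|eA] := boolP (e \in A).
  by rewrite (bigD1 e) //= eqxx big1 // => i /andP[_ /negPf->].
by rewrite big1 // => i iA; case: eqP => // ie; rewrite -ie iA in eA.
Qed.

Lemma mdeg_mon_sum_var A : mdeg (mon_sum (fun e : 'I_m => U_(e)%MM) A) = #|A|.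
Proof.
by rewrite mdeg_sum -sum1_card; apply: eq_bigr => e _; rewrite mdeg1.
Qed.

(** The divisor complex is here the full simplex on the support of [b]. *)
Lemma simplex_acyclic (b : 'X_{1..m}) (p : nat) : b != 0%MM ->
  acyclic_at k (divisor_complex (fun e : 'I_m => U_(e)%MM) predT b) p.
Proof.
move=> nzb; have [e0 be0] : exists e, (0 < b e)%N.
  have [e be|b0] := pickP (fun e => 0 < b e)%N; first by exists e.
  case/eqP: nzb; apply/mnmP=> e; rewrite mnm0E; apply/eqP.
  by rewrite -leqn0 leqNgt b0.
have DP A : divisor_complex (fun e : 'I_m => U_(e)%MM) predT b A =
    [forall e in A, 0 < b e]%N.
  rewrite /divisor_complex andbT; apply/mnm_lepP/forall_inP => le e.
    by move=> eA; have := le e; rewrite mon_sum_varE eA.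
  by rewrite mon_sum_varE; case: (boolP (e \in A)) => // /le.
apply: (@acyclic_of_toggle _ _ _ nat _ _ (fun=> 0%N) (fun _ e => 0 < b e)%N).
- by move=> e A; apply: divisor_complex_down.
- by [].
- move=> e A; rewrite !DP => /forall_inP DA be; split=> //.
  by apply/forall_inP=> i; rewrite !inE => /predU1P[->|/DA].
- by move=> A _ _; exists e0.
Qed.

(** Only the constant term of [z set0] can obstruct: it is the part of
   multidegree zero, where the divisor complex is reduced to the empty face.
   The last clause records that the filling [y] stays in the degrees of [z]. *)
Lemma koszul_exact_poly (z : {set 'I_m} -> S^o) (p : nat) :
    (forall A c, c \in msupp (z A) -> #|A| = p) ->
    (z set0)@_0%MM = 0 -> koszul_bd X z =1 (fun=> 0) ->
  exists2 y : {set 'I_m} -> S^o,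
    forall A c, c \in msupp (y A) -> #|A| = p.+1 /\ exists A' c',
      c' \in msupp (z A') /\ (mdeg c + #|A| = mdeg c' + #|A'|)%N
    & z =1 koszul_bd X y.
Proof.
move=> zp z00 z0.
have [A c /zp//|//|A c zc|y yP zE] := @koszul_exact_of_strands k m m
  (fun e : 'I_m => U_(e)%MM) predT z p.
  apply: simplex_acyclic; apply: contraTneq zc => b0.
  have c0 : c = 0%MM.
    by apply/mnmP=> i; move/mnmP/(_ i): b0; rewrite mnmDE mnm0E; lia.
  have A0 : A = set0.
    apply/setP=> i; move/mnmP/(_ i): b0.
    by rewrite mnmDE mnm0E mon_sum_varE inE; case: (i \in A); lia.
  by rewrite mcoeff_msupp c0 A0 z00 eqxx.
exists y => // A c /yP[_ cA [A' [c' [zc' E]]]]; split=> //; exists A', c'.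
split=> //; have := congr1 mdeg E.
by rewrite !mdegD !mdeg_mon_sum_var.
Qed.

Lemma koszul_bd_mulmx r s (z : {set 'I_m} -> 'rV[S]_r) (M : 'M[S]_(r, s)) A :
  koszul_bd X (fun B => z B *m M) A = koszul_bd X z A *m M.
Proof.
by rewrite /koszul_bd mulmx_suml; apply: eq_bigr => e _; rewrite scalemxAl.
Qed.

Lemma koszul_bd_coord r (z : {set 'I_m} -> 'rV[S]_r) A b :
  koszul_bd X z A 0 b = koszul_bd X (fun B => z B 0 b : S^o) A.
Proof.
by rewrite /koszul_bd summxE; apply: eq_bigr => e _; rewrite mxE.
Qed.

Lemma mcoeff_mulmx r s (u : 'rV[S]_r) (M : 'M[S]_(r, s)) b c :
    c \in msupp ((u *m M) 0 b) -> exists a c1 c2,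
  [/\ c1 \in msupp (u 0 a), c2 \in msupp (M a b) & c = (c1 + c2)%MM].
Proof.
rewrite mxE => /msupp_sum_le /flatten_mapP[a _ /msuppM_le /allpairsP].
by case=> [[c1 c2]] [? ? ->]; exists a, c1, c2.
Qed.

Variables (I : {pred S}) (F : free_complex k m).
Hypothesis I_sub : forall p q : S, p \in I -> q \in I -> p - q \in I.
Hypothesis I_mul : forall p q : S, q \in I -> p * q \in I.
Hypothesis F_res : minimal_graded_free_resolution I F.

(** Vanishing of the part of internal degree [i + rho] of the [i]-th Koszul
   homology of the quotient by [I], with chains lifted to [S]. *)
Definition koszul_vanish (i rho : nat) : Prop :=
  forall z : {set 'I_m} -> S^o,
    (forall A c, c \in msupp (z A) -> #|A| = i /\ mdeg c = rho) ->
    (forall A, koszul_bd X z A \in I) ->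
  exists y : {set 'I_m} -> S^o, forall A, z A - koszul_bd X y A \in I.

Definition hom_chain (D p q : nat) (z : {set 'I_m} -> 'rV[S]_(rk F q)) :=
  forall A b c, c \in msupp (z A 0 b) ->
    #|A| = p /\ (mdeg c + p + shift b = D)%N.

(** The condition for a chain of bidegree [(p, q)] in the double complex of the
   Koszul complex and [F] to start a zigzag: its image under the differential of
   [F] is a Koszul cycle, without constant term if [p = 0], hence a boundary. *)
Definition zigzag_start (p q : nat) : ({set 'I_m} -> 'rV[S]_(rk F q)) -> Prop :=
  match q with
  | 0 => fun z => forall A, (koszul_bd X z A *m aug F) 0 0 \in I
  | q'.+1 => fun z => (forall A, koszul_bd X z A *m diff F q' = 0) /\
      (p = 0%N -> forall b, ((z set0 *m diff F q') 0 b)@_0%MM = 0)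
  end.

Lemma zigzag_next q p (z : {set 'I_m} -> 'rV[S]_(rk F q.+1))
    (z' : {set 'I_m} -> 'rV[S]_(rk F q)) :
  (forall A, z A *m diff F q = koszul_bd X z' A) -> zigzag_start p.+1 z'.
Proof.
have [_ [_ res1 res2] _] := F_res.
case: q z z' => [|q] z z' zE /=.
  by move=> A; rewrite -zE; apply/res1; exists (z A).
by split=> // A; rewrite -zE; apply/res2; exists (z A).
Qed.

(** The image of [z] under the differential of [F] is a Koszul boundary; its
   filling is again the start of a zigzag, one step closer to [q = 0], where the
   chain maps to the Koszul complex of the quotient and the vanishing assumption
   applies. *)
Lemma zigzag (i rho : nat) : koszul_vanish i rho ->
  forall q p (z : {set 'I_m} -> 'rV[S]_(rk F q)), (p + q)%N = i ->
    hom_chain (i + rho) p z -> zigzag_start p z ->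
  exists Y : {set 'I_m} -> 'rV[S]_(rk F q),
  exists Y' : {set 'I_m} -> 'rV[S]_(rk F q.+1),
    forall A, z A = koszul_bd X Y A + Y' A *m diff F q.
Proof.
have [[deg_aug deg_diff] [res0 res1 res2] _] := F_res.
move=> vanish; elim=> [|q IHq] p z pq zhom.
  rewrite addn0 in pq; move=> zI.
  pose t A : S^o := (z A *m aug F) 0 0.
  have [A c|A|y yE] := vanish t.
  - case/mcoeff_mulmx=> a [c1 [c2 [/zhom[cA dc1] /deg_aug dc2 ->]]].
    by split; [rewrite cA | rewrite mdegD; lia].
  - have := zI A; rewrite -koszul_bd_mulmx koszul_bd_coord; exact.
  have [u uE] := fin_all_exists (fun A => res0 (y A)).
  suff [w wE] : exists w : {set 'I_m} -> 'rV[S]_(rk F 1),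
      forall A, z A - koszul_bd X u A = w A *m diff F 0.
    by exists u, w => A; rewrite -wE addrC subrK.
  apply: (@fin_all_exists _ _ (fun A w => z A - koszul_bd X u A = w *m diff F 0)).
  move=> A; apply/res1; rewrite mulmxBl -koszul_bd_mulmx.
  rewrite mxE [X in _ + X]mxE koszul_bd_coord.
  pose v B : S^o := y B - (u B *m aug F) 0 0.
  have vI : - koszul_bd X v A \in I.
    rewrite /koszul_bd; elim/big_rec: _ => [|e x eA xI].
      by have := I_mul 0 (uE set0); rewrite mul0r oppr0.
    by rewrite opprD addrC; apply: I_sub => //; apply: I_mul; apply: uE.
  have := I_sub (yE A) vI; rewrite opprK /v koszul_bdB.
  by rewrite addrA subrK.
case=> zd zconst.
pose dz A := z A *m diff F q.
have dz0 A : koszul_bd X dz A = 0 by rewrite koszul_bd_mulmx zd.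
have dzhom : hom_chain (i + rho) p dz.
  move=> A b c /mcoeff_mulmx[a [c1 [c2 [/zhom[cA dc1] /deg_diff dc2 ->]]]].
  by split=> //; rewrite mdegD; lia.
have dz00 b : (dz set0 0 b)@_0%MM = 0.
  have [p0|p0] := posnP p; first exact: zconst.
  apply: memN_msupp_eq0; apply/negP => /dzhom[]; rewrite cards0 => p1.
  by rewrite -p1 in p0.
have [z' z'E] : exists z' : {set 'I_m} -> 'rV[S]_(rk F q),
    hom_chain (i + rho) p.+1 z' /\ forall A, dz A = koszul_bd X z' A.
  have coord b : exists y : {set 'I_m} -> S^o,
      (forall A c, c \in msupp (y A) ->
         #|A| = p.+1 /\ (mdeg c + p.+1 + shift b = i + rho)%N) /\
      forall A, dz A 0 b = koszul_bd X y A.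
    have [A c /dzhom[]//|//|A|y yP yE] :=
      @koszul_exact_poly (fun A => dz A 0 b) p.
      by rewrite -koszul_bd_coord dz0 mxE.
    exists y; split=> // A c /yP[cA [A' [c' [/dzhom[cA' dc'] E]]]]; split=> //.
    by rewrite -cA E cA'.
  have [y yP] := fin_all_exists coord.
  exists (fun A => \row_b y b A); split=> [A b c|A].
    by rewrite mxE => /(proj1 (yP b)).
  apply/rowP=> b; rewrite koszul_bd_coord (proj2 (yP b)).
  by apply: eq_bigr => e _; rewrite mxE.
have [z'hom {}z'E] := z'E.
have [||Y [Y' YE]] := IHq p.+1 z' _ z'hom; first by rewrite addSnnS.
  exact: zigzag_next z'E.
exists Y'.
apply: (@fin_all_exists _ _
  (fun A w => z A = koszul_bd X Y' A + w *m diff F q.+1)) => A.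
have [w wE] : exists w, z A - koszul_bd X Y' A = w *m diff F q.+1.
  apply/res2; rewrite mulmxBl -koszul_bd_mulmx -/(dz A) z'E -koszul_bdB.
  rewrite (eq_koszul_bd _ (z' := koszul_bd X Y)) ?koszul_bd_bd // => B.
  by rewrite YE addrK.
by exists w; rewrite -wE addrC subrK.
Qed.

Definition basis_chain q (a : 'I_(rk F q)) A : 'rV[S]_(rk F q) :=
  if A == set0 then delta_mx 0 a else 0.

Lemma basis_chain_start q (a : 'I_(rk F q)) : zigzag_start 0 (basis_chain a).
Proof.
have bd0 A : koszul_bd X (basis_chain a) A = 0.
  rewrite /koszul_bd big1 // => e _; rewrite /basis_chain; case: eqP => [eA0|_].
    by have := setU11 e A; rewrite eA0 inE.
  by rewrite scaler0.
have [_ [res0 _ _] Fmin] := F_res.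
case: q a bd0 => [|q] a bd0 /=.
  move=> A; rewrite bd0 mul0mx mxE.
  by have [u uI] := res0 0; have := I_mul 0 uI; rewrite mul0r.
split=> [A|_ b]; first by rewrite bd0 mul0mx.
by rewrite /basis_chain eqxx -rowE mxE Fmin.
Qed.

(** A basis element of [F] of degree [i + rho] in homological degree [i] starts
   a zigzag, by minimality; the zigzag puts it into the sum of the image of the
   next differential and the multiples of the variables, where no basis element
   of a minimal complex lies. *)
Lemma no_generator (i rho : nat) (a : 'I_(rk F i)) :
  koszul_vanish i rho -> shift a <> (i + rho)%N.
Proof.
move=> vanish deg_a; have [_ _ Fmin] := F_res.
have [|Y [Y' E]] := zigzag vanish (add0n i) _ (basis_chain_start a).
  move=> A b c; rewrite /basis_chain; case: eqP => [->|_]; last first.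
    by rewrite mxE mcoeff_msupp mcoeff0 eqxx.
  rewrite mxE eqxx /=; case: eqP => [->|_]; last first.
    by rewrite mcoeff_msupp mcoeff0 eqxx.
  rewrite mcoeff_msupp mulr1n mcoeff1.
  case: (eqVneq c 0%MM) => [->|_]; last by rewrite eqxx.
  by rewrite cards0 mdeg0.
have /(congr1 (mcoeff 0%MM)) := congr1 (fun u : 'rV_(rk F i) => u 0 a) (E set0).
rewrite /basis_chain eqxx mxE !eqxx mulr1n mcoeff1 eqxx mxE mcoeffD koszul_bd_coord.
have -> : (koszul_bd X (fun B => Y B 0 a : S^o) set0)@_0%MM = 0.
  rewrite /koszul_bd raddf_sum big1 // => e _ /=.
  rewrite -scalerA mcoeff_sign mcoeffXM ifF ?mulr0 //.
  by apply/negP=> /mnm_lepP/(_ e); rewrite mnm1E eqxx mnm0E.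
rewrite mxE raddf_sum big1 ?addr0 => [/eqP|j _ /=]; first by rewrite oner_eq0.
apply: memN_msupp_eq0; apply/negP=> /msuppM_le /allpairsP[[c1 c2] /= [_ + /eqP]].
rewrite eq_sym => c2F; rewrite -mdeg_eq0 mdegD addn_eq0 => /andP[_].
rewrite mdeg_eq0 => /eqP c20; move: c2F.
by rewrite c20 mcoeff_msupp Fmin eqxx.
Qed.

End PolynomialKoszul.

(** * Lexicographically minimal flows on a bipartite graph *)

Section Flows.
Variables (U : finType) (m : nat) (src tgt : 'I_m -> U) (A : {set U}).
Hypothesis srcA : forall e, src e \in A.
Hypothesis tgtA : forall e, tgt e \notin A.
Implicit Types (e : 'I_m) (u : U) (f g x z : 'rV[rat]_m) (t : U -> rat).

Definition incident e u : bool := (u == src e) || (u == tgt e).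

Definition flow_deg f u : rat := \sum_(e | incident e u) f 0 e.

Lemma flow_degD f g u : flow_deg (f + g) u = flow_deg f u + flow_deg g u.
Proof. by rewrite -big_split; apply: eq_bigr => e _; rewrite mxE. Qed.

Lemma flow_degZ a f u : flow_deg (a *: f) u = a * flow_deg f u.
Proof. by rewrite mulr_sumr; apply: eq_bigr => e _; rewrite mxE. Qed.

Lemma flow_degN f u : flow_deg (- f) u = - flow_deg f u.
Proof. by rewrite -scaleN1r flow_degZ mulN1r. Qed.

Lemma flow_deg_delta e u : flow_deg (delta_mx 0 e) u = (incident e u)%:R.
Proof.
rewrite /flow_deg; have [eu|eu] := boolP (incident e u).
  rewrite (bigD1 e) //= mxE !eqxx big1 ?addr0 // => i /andP[_ /negPf ne].
  by rewrite mxE ne andbF.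
rewrite big1 // => i iu; rewrite mxE eqxx; case: (eqVneq i e) => //= ie.
by rewrite -ie iu in eu.
Qed.

Lemma flow_deg_sum (B : {set U}) (end_ : 'I_m -> U) f :
    (forall e u, u \in B -> incident e u = (u == end_ e)) ->
    (forall e, end_ e \in B) ->
  \sum_(u in B) flow_deg f u = \sum_e f 0 e.
Proof.
move=> incE endB; rewrite /flow_deg (exchange_big_dep predT) //=.
apply: eq_bigr => e _; rewrite (bigD1 (end_ e)) /= ?endB ?incE ?eqxx //.
by rewrite big1 ?addr0 // => u /andP[/andP[uB]]; rewrite incE // => ->.
Qed.

Lemma flow_deg_sumA f : \sum_(u in A) flow_deg f u = \sum_e f 0 e.
Proof.
apply: (@flow_deg_sum _ src) => // e u uA; rewrite /incident orbC.
by case: eqP => // ut; have := tgtA e; rewrite -ut uA.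
Qed.

Lemma flow_deg_sumC f : \sum_(u in ~: A) flow_deg f u = \sum_e f 0 e.
Proof.
apply: (@flow_deg_sum _ tgt) => [e u|e]; rewrite !inE // => uA.
by rewrite /incident; case: eqP => // ut; have := srcA e; rewrite -ut (negPf uA).
Qed.

Lemma flow_deg_last z u0 :
  (forall u, u != u0 -> flow_deg z u = 0) -> forall u, flow_deg z u = 0.
Proof.
move=> z0 u; have [->|/z0//] := eqVneq u u0.
have := flow_deg_sumA z; rewrite -flow_deg_sumC.
have [uA|uA] := boolP (u0 \in A).
  rewrite (bigD1 u0) //= [X in _ + X]big1 => [|v /andP[_ /z0//]].
  rewrite addr0 big1 // => v; rewrite inE => vA; apply: z0.
  by apply: contraNneq vA => ->.
rewrite [RHS](bigD1 u0) ?inE //= [X in _ = _ + X]big1 => [|v /andP[_ /z0//]].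
rewrite addr0 big1 // => v vA; apply: z0.
by apply: contraNneq uA => <-.
Qed.

Lemma exists_kernel (X : {set 'I_m}) (Y : {set U}) : (#|Y| < #|X|)%N ->
  exists z, [/\ z != 0, forall e, e \notin X -> z 0 e = 0
    & forall u, u \in Y -> flow_deg z u = 0].
Proof.
move=> ltYX.
pose M : 'M[rat]_(#|X|, #|Y|) :=
  \matrix_(i, j) (incident (enum_val i) (enum_val j))%:R.
have /rowV0Pn[v /sub_kermxP vM nzv] : kermx M != 0.
  rewrite kermx_eq0 /row_free; apply: contraTneq ltYX => <-.
  by rewrite -leqNgt rank_leq_col.
pose z : 'rV[rat]_m := \row_e \sum_i (if enum_val i == e then v 0 i else 0).
have zE i : z 0 (enum_val i) = v 0 i.
  rewrite mxE (bigD1 i) //= eqxx big1 ?addr0 // => j ne.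
  by rewrite (inj_eq enum_val_inj) (negPf ne).
exists z; split=> [|e eX|u uY].
- apply: contraNneq nzv => z0; apply/eqP/rowP=> i.
  by rewrite -zE z0 !mxE.
- rewrite mxE big1 // => i _; case: eqP => // ie.
  by rewrite -ie enum_valP in eX.
have := congr1 (fun w : 'rV_(#|Y|) => w 0 (enum_rank_in uY u)) vM.
rewrite mxE [RHS]mxE => E; rewrite /flow_deg -[RHS]E.
under eq_bigr => e _ do rewrite mxE.
rewrite exchange_big /=; apply: eq_bigr => i _.
rewrite mxE enum_rankK_in // big_mkcond /= (bigD1 (enum_val i)) //= eqxx.
rewrite big1 ?addr0 => [|e ne].
  by case: incident; rewrite ?mulr1 ?mulr0.
by rewrite eq_sym (negPf ne) if_same.
Qed.

Lemma ratio_test (T : finType) (f z : T -> rat) i0 :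
    (forall i, 0 <= f i) -> z i0 < 0 ->
  exists2 s, 0 <= s & (forall i, 0 <= f i + s * z i) /\
    exists2 i, z i < 0 & f i + s * z i = 0.
Proof.
move=> f0 zi0.
have [i zi mini] : exists2 i, z i < 0
    & forall j, z j < 0 -> f i / - z i <= f j / - z j.
  case: (@Order.TotalTheory.arg_minP _ _ _ i0 (fun i => z i < 0)
    (fun i => f i / - z i) zi0) => i ? ?; by exists i.
have s0 : 0 <= f i / - z i by rewrite divr_ge0 // oppr_ge0 ltW.
exists (f i / - z i) => //; split=> [j|]; last first.
  by exists i => //; field; rewrite lt_eqF.
have [zj|zj] := ltP (z j) 0; last by rewrite addr_ge0 // mulr_ge0.
have := mini j zj; rewrite ler_pdivlMr ?oppr_gt0 // => le.
by rewrite -[z j]opprK mulrN subr_ge0.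
Qed.

Definition lexv f : m.-tuplelexi rat := [tuple f 0 e | e < m].

Lemma lexv_ltP f g : reflect
  (exists2 e : 'I_m, forall i : 'I_m, (i < e)%N -> f 0 i = g 0 i
     & f 0 e < g 0 e)
  (lexv f < lexv g)%O.
Proof.
apply: (iffP ltxi_tuplePlt) => -[e eq lt]; exists e.
- by move=> i /eq; rewrite !tnth_mktuple.
- by rewrite !tnth_mktuple in lt.
- by move=> i /eq; rewrite !tnth_mktuple.
- by rewrite !tnth_mktuple.
Qed.

Lemma lexv_inj : injective lexv.
Proof.
by move=> f g /(congr1 (fun v => tnth v _)) E; apply/rowP=> e;
  have := E e; rewrite !tnth_mktuple.
Qed.

Lemma lexv_lt_scale s f g f' g' : 0 < s -> f' - g' = s *: (f - g) ->
  (lexv f < lexv g)%O -> (lexv f' < lexv g')%O.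
Proof.
move=> s0 E /lexv_ltP[e eq lt].
have D i : f' 0 i - g' 0 i = s * (f 0 i - g 0 i).
  by have := congr1 (fun w : 'rV_m => w 0 i) E; rewrite !mxE.
apply/lexv_ltP; exists e => [i /eq fg|].
  by apply/eqP; rewrite -subr_eq0 D fg subrr mulr0.
by rewrite -subr_lt0 D pmulr_rlt0 // subr_lt0.
Qed.

Lemma lexv_le_add f g z : (lexv f <= lexv g)%O -> (lexv (f + z) <= lexv (g + z))%O.
Proof.
rewrite !leNgt; apply: contraNN; apply: (@lexv_lt_scale 1) => //.
by rewrite scale1r opprD addrACA subrr addr0.
Qed.

Definition feasible t f := (forall e, 0 <= f 0 e) /\ flow_deg f =1 t.

(** The support of [f] contains no support of a nonzero circulation, that is,
   it is the edge set of a forest. *)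
Definition forest_supported f := forall z,
  flow_deg z =1 (fun=> 0) -> (forall e, f 0 e = 0 -> z 0 e = 0) -> z = 0.

Definition lexmin t f :=
  feasible t f /\ forall g, feasible t g -> (lexv f <= lexv g)%O.

Definition support f : {set 'I_m} := [set e | f 0 e != 0].

Lemma circulation_neg z : flow_deg z =1 (fun=> 0) -> z != 0 ->
  exists e, z 0 e < 0.
Proof.
move=> z0 nz; have [e //|zpos] := pickP (fun e => z 0 e < 0); first by exists e.
case/eqP: nz; apply/rowP=> e; rewrite mxE; apply/eqP.
have := flow_deg_sumA z; rewrite big1 // => /esym/eqP.
rewrite psumr_eq0 => [/allP/(_ e)|i _]; first by rewrite mem_index_enum; apply.
by rewrite leNgt zpos.
Qed.

(** The step stops when an edge is emptied; it has positive length because only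
   edges that carry flow are decreased. *)
Lemma feasible_move t f z e0 : feasible t f -> flow_deg z =1 (fun=> 0) ->
    (forall e, z 0 e < 0 -> 0 < f 0 e) -> z 0 e0 < 0 ->
  exists2 s, 0 < s & feasible t (f + s *: z) /\
    exists2 e, 0 < f 0 e & (f + s *: z) 0 e = 0.
Proof.
move=> [f0 ft] z0 zneg ze0.
have [s s0 [fs [e ze fe]]] := ratio_test f0 ze0.
have s_gt0 : 0 < s.
  rewrite lt_def s0 andbT; apply: contraTneq (zneg e ze) => s00.
  by rewrite s00 mul0r addr0 in fe; rewrite fe ltxx.
exists s => //; split; last by exists e; rewrite ?zneg // !mxE.
split=> [i|u]; first by rewrite !mxE.
by rewrite flow_degD flow_degZ z0 mulr0 addr0.
Qed.

Lemma lexv_move s f z : 0 < s -> (lexv z < lexv 0)%O -> (lexv (f + s *: z) < lexv f)%O.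
Proof.
by move=> s0; apply: (@lexv_lt_scale s) => //; rewrite subr0 addrC addKr.
Qed.

Lemma lexv_opp z : z != 0 -> (lexv z < lexv 0)%O \/ (lexv (- z) < lexv 0)%O.
Proof.
move=> nz; have [| gt | /lexv_inj z0] := ltgtP (lexv z) (lexv 0); first by left.
  right; apply: (@lexv_lt_scale 1 0 z) => //.
  by rewrite scale1r subr0 sub0r.
by rewrite z0 eqxx in nz.
Qed.

(** As long as the support contains a circulation, the flow can be moved along it
   in the lexicographically decreasing direction until the support shrinks. *)
Lemma feasible_forest t f : feasible t f ->
  exists g, [/\ feasible t g, forest_supported g & (lexv g <= lexv f)%O].
Proof.
have [n] := ubnP #|support f|; elim: n f => // n IHn f le_n feas.
have [free|nfree] := excluded_middle_informative (forest_supported f).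
  by exists f.
have [z [z0 zf nz]] : exists z, [/\ flow_deg z =1 (fun=> 0),
    forall e, f 0 e = 0 -> z 0 e = 0 & z != 0].
  apply: NNPP => none; apply: nfree => z z0 zf; apply/eqP; apply: contraT => nz.
  by case: none; exists z.
wlog zlex : z z0 zf nz / (lexv z < lexv 0)%O => [wl|].
  have [|zneg] := lexv_opp nz; first exact: wl.
  apply: (wl (- z)); rewrite ?oppr_eq0 //.
    by move=> u; rewrite flow_degN z0 oppr0.
  by move=> e /zf ze; rewrite mxE ze oppr0.
have [e0 ze0] := circulation_neg z0 nz.
have zpos e : z 0 e < 0 -> 0 < f 0 e.
  move=> ze; rewrite lt_def (proj1 feas) andbT.
  by apply: contraTneq ze => /zf->; rewrite ltxx.
have [s s0 [feas' [e fe fe']]] := feasible_move feas z0 zpos ze0.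
have [|g [gfeas gfree gle]] := IHn (f + s *: z) _ feas'.
  rewrite -ltnS; apply: leq_trans le_n; rewrite ltnS.
  apply: proper_card; apply/properP; split.
    apply/subsetP=> i; rewrite !inE; apply: contraNneq => fi.
    by rewrite !mxE fi zf // mulr0 addr0.
  by exists e; rewrite inE ?fe' ?eqxx // gt_eqF.
exists g; split=> //; apply: le_trans gle _; apply: ltW; exact: lexv_move.
Qed.

Lemma forest_flow_eq t f g : feasible t f -> feasible t g ->
  forest_supported f -> support f = support g -> f = g.
Proof.
move=> [_ ft] [_ gt] free supp; apply/esym/eqP; rewrite -subr_eq0; apply/eqP.
apply: free => [u|e fe]; first by rewrite flow_degD flow_degN gt ft subrr.
have : e \notin support g by rewrite -supp inE fe eqxx.
by rewrite inE negbK !mxE fe => /eqP->; rewrite subrr.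
Qed.

(** Only finitely many flows compete, one for each forest. *)
Lemma lexmin_exists t f0 : feasible t f0 -> exists f, lexmin t f.
Proof.
move=> feas0.
(* Minimization over a list of supports, each carrying at most one candidate. *)
pose cand (Xs : seq {set 'I_m}) f :=
  [/\ feasible t f, forest_supported f & support f \in Xs].
suff best Xs : (exists f, cand Xs f) ->
    exists2 f, cand Xs f & forall g, cand Xs g -> (lexv f <= lexv g)%O.
  have [|f [feas free _] fmin] := best (enum {: {set 'I_m}}).
    have [g [? ? _]] := feasible_forest feas0; exists g; split=> //.
    by rewrite mem_enum.
  exists f; split=> // g /feasible_forest[g' [? ? le]]; apply: le_trans le.
  by apply: fmin; split; rewrite ?mem_enum.
elim: Xs => [[f []//]|X Xs IH] [f1 cand1].
have keep f : cand Xs f -> cand (X :: Xs) f.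
  by case=> ? ? fXs; split=> //; rewrite inE fXs orbT.
have [[f2 [feas2 free2 supp2]]|noX] := excluded_middle_informative
  (exists f, [/\ feasible t f, forest_supported f & support f = X]); last first.
  have drop f : cand (X :: Xs) f -> cand Xs f.
    move=> [feas free]; rewrite inE => /orP[/eqP X_f|//].
    by case: noX; exists f.
  have [|f /keep candf fmin] := IH; first by exists f1; apply: drop.
  by exists f => // g /drop/fmin.
have cand2 : cand (X :: Xs) f2 by split; rewrite // supp2 inE eqxx.
have split_cand g : cand (X :: Xs) g -> g = f2 \/ cand Xs g.
  move=> [feas free]; rewrite inE => /orP[/eqP X_g|gXs]; last by right.
  by left; apply: forest_flow_eq feas feas2 free _; rewrite X_g.
have [candXs|none] := excluded_middle_informative (exists f, cand Xs f).
  have [f /keep candf fmin] := IH candXs.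
  have [le|/ltW le] := leP (lexv f) (lexv f2); [exists f | exists f2] => // g.
    by case/split_cand=> [->|/fmin].
  by case/split_cand=> [->|/fmin]; last exact: le_trans.
by exists f2 => // g /split_cand[->|candg] //; case: none; exists g.
Qed.

Lemma lexmin_forest t f : lexmin t f -> forest_supported f.
Proof.
move=> [feas fmin]; have [g [feasg free le]] := feasible_forest feas.
by have -> : f = g by apply/lexv_inj/le_anti; rewrite le fmin.
Qed.

(** A better flow for the new degrees would yield, by convexity, a better one
   for the old degrees, because the support has not changed. *)
Lemma lexmin_add t t' f e : lexmin t f -> 0 < f 0 e ->
    (forall u, t' u = t u + (incident e u)%:R) ->
  lexmin t' (f + delta_mx 0 e).
Proof.
move=> [feas fmin] fe t'E; have [f0 ft] := feas; split.
  split=> [i|u]; last by rewrite flow_degD flow_deg_delta ft t'E.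
  by rewrite !mxE addr_ge0 // ler0n.
move=> h [h0 ht]; rewrite leNgt; apply/negP=> lt.
pose z := h - (f + delta_mx 0 e).
have z0 : flow_deg z =1 (fun=> 0).
  by move=> u; rewrite flow_degD flow_degN flow_degD flow_deg_delta ht ft t'E subrr.
have zlex : (lexv z < lexv 0)%O.
  by apply: lexv_lt_scale lt => //; rewrite subr0 scale1r.
have nz : z != 0 by apply: contraTneq zlex => ->; rewrite ltxx.
have zpos i : z 0 i < 0 -> 0 < f 0 i.
  have [->//|ne] := eqVneq i e; rewrite !mxE (negPf ne) andbF addr0 subr_lt0.
  exact: le_lt_trans.
have [i zi] := circulation_neg z0 nz.
have [s s0 [feas' _]] := feasible_move feas z0 zpos zi.
by have := fmin _ feas'; rewrite leNgt lexv_move.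
Qed.

Lemma lexmin_sub t t' f e : lexmin t f -> 1 <= f 0 e ->
    (forall u, t u = t' u + (incident e u)%:R) ->
  lexmin t' (f - delta_mx 0 e).
Proof.
move=> [[f0 ft] fmin] fe tE; split.
  split=> [i|u]; last first.
    by rewrite flow_degD flow_degN flow_deg_delta ft tE addrK.
  by rewrite !mxE eqxx; case: (eqVneq i e) => [->|_] /=; rewrite ?subr0 ?subr_ge0.
move=> h [h0 ht]; rewrite -[h](addrK (delta_mx 0 e)); apply: lexv_le_add.
apply: fmin; split=> [i|u]; last by rewrite flow_degD flow_deg_delta ht tE.
by rewrite !mxE addr_ge0 // ler0n.
Qed.

(** The degree conditions at all vertices but one imply the last one, so a
   support with as many edges as there are vertices would carry a circulation. *)
Lemma card_forest f (u0 : U) : forest_supported f -> (#|support f| < #|U|)%N.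
Proof.
move=> free; rewrite ltnNge; apply/negP=> le.
have [|z [nz zX zY]] := @exists_kernel (support f) [set~ u0].
  by rewrite cardsC1; apply: leq_trans le; rewrite ltn_predL; apply/card_gt0P; exists u0.
case/eqP: nz; apply: free => [|e fe]; last by rewrite zX // inE fe eqxx.
by apply: (@flow_deg_last z u0) => u ne; apply: zY; rewrite !inE.
Qed.

(** * Rounding fractional flows *)

Definition frac_edges x : {set 'I_m} := [set e | x 0 e \isn't a Num.int].

Definition frac_verts x : {set U} := [set u | flow_deg x u \isn't a Num.int].

Lemma int_flow_deg x u : (forall e, incident e u -> x 0 e \is a Num.int) ->
  flow_deg x u \is a Num.int.
Proof. by move=> xi; apply: rpred_sum => e /xi. Qed.

Lemma card_incident_sum (X : {set 'I_m}) :
  (\sum_u #|[set e in X | incident e u]| = 2 * #|X|)%N.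
Proof.
under eq_bigr => u _ do rewrite -sum1dep_card big_mkcondr.
rewrite exchange_big /= mulnC -sum_nat_const; apply: eq_bigr => e _.
rewrite -big_mkcond sum1dep_card.
have -> : [set u | incident e u] = [set src e; tgt e].
  by apply/setP=> u; rewrite !inE.
rewrite cards2; case: eqP => // st.
by have := tgtA e; rewrite -st srcA.
Qed.

Lemma card_frac_incident x u : flow_deg x u \is a Num.int ->
  #|[set e in frac_edges x | incident e u]| != 1%N.
Proof.
move=> degi; apply/cards1P=> -[e0 E].
have : e0 \in [set e in frac_edges x | incident e u] by rewrite E inE.
rewrite !inE => /andP[/negP xe0 inc0]; apply: xe0.
have -> : x 0 e0 = flow_deg x u - \sum_(e | incident e u && (e != e0)) x 0 e.
  by rewrite /flow_deg (bigD1 e0) //= addrK.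
apply: rpredB => //; apply: rpred_sum => e /andP[inc ne].
have : e \notin [set e in frac_edges x | incident e u] by rewrite E inE.
by rewrite !inE inc andbT negbK.
Qed.

(** Every vertex of integral degree that meets a fractional edge meets two of
   them, so the fractional edges outnumber the conditions that keep these
   degrees fixed; when all degrees are integral, one condition follows from the
   others. *)
Lemma frac_direction x : frac_edges x != set0 -> exists z,
  [/\ z != 0, forall e, e \notin frac_edges x -> z 0 e = 0
    & forall u, u \notin frac_verts x -> flow_deg z u = 0].
Proof.
move=> /set0Pn[e1 xe1].
pose dX u := #|[set e in frac_edges x | incident e u]|.
pose Y0 := [set u | (u \notin frac_verts x) && (dX u != 0%N)].
have untouched z u : (forall e, e \notin frac_edges x -> z 0 e = 0) ->
    dX u = 0%N -> flow_deg z u = 0.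
  move=> zX /eqP; rewrite cards_eq0 => /eqP dX0.
  rewrite /flow_deg big1 // => e inc; apply: zX.
  have : e \notin [set e in frac_edges x | incident e u] by rewrite dX0 inE.
  by rewrite inE inc andbT.
have count : (2 * #|Y0| + #|frac_verts x| <= 2 * #|frac_edges x|)%N.
  rewrite -card_incident_sum -/dX (bigID (mem (frac_verts x))) /= addnC leq_add //.
    rewrite -sum1_card; apply: leq_sum => u; rewrite inE => /negP du.
    rewrite lt0n; apply/negP=> /eqP dX0; apply: du; apply: int_flow_deg => e inc.
    have : e \notin [set e in frac_edges x | incident e u].
      by move/eqP: dX0; rewrite cards_eq0 => /eqP->; rewrite inE.
    by rewrite !inE inc andbT negbK.
  rewrite mulnC -sum_nat_const [leqRHS](bigID (fun u => dX u != 0%N)) /=.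
  rewrite -[leqLHS]addn0 leq_add //.
  rewrite (eq_bigl (fun u => (u \notin frac_verts x) && (dX u != 0%N))).
    apply: leq_sum => u /andP[uF du].
    have : dX u != 1%N by apply: card_frac_incident; rewrite inE negbK in uF.
    by rewrite /dX in du *; case: #|_| du => [|[]].
  by move=> u; rewrite inE.
have [Y [ltY Yzero]] : exists Y : {set U}, (#|Y| < #|frac_edges x|)%N /\
    forall z, (forall e, e \notin frac_edges x -> z 0 e = 0) ->
      (forall u, u \in Y -> flow_deg z u = 0) ->
    forall u, u \notin frac_verts x -> flow_deg z u = 0.
  have [F0|Fn0] := eqVneq (frac_verts x) set0; last first.
    exists Y0; split.
      have : (0 < #|frac_verts x|)%N by rewrite card_gt0.
      by lia.
    move=> z zX zY u uF; have [/untouched->//|du] := eqVneq (dX u) 0%N.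
    by apply: zY; rewrite inE uF.
  have srcY : src e1 \in Y0.
    rewrite in_set F0 in_set0 /= cards_eq0; apply/set0Pn; exists e1.
    by rewrite in_set xe1 /incident eqxx.
  exists (Y0 :\ src e1); split.
    have := cardsD1 (src e1) Y0; rewrite srcY; lia.
  move=> z zX zY u _; apply: (@flow_deg_last z (src e1)) => v ne.
  have [/untouched->//|dv] := eqVneq (dX v) 0%N.
  by apply: zY; rewrite in_setD1 ne in_set F0 in_set0.
have [z [nz zX zY]] := exists_kernel ltY; exists z; split=> //.
exact: Yzero.
Qed.

(** As the total stays below the sum of the demands plus one, covering the
   demands [c] by an integral flow means meeting them exactly.  A fractional
   flow is moved along a direction that does not increase the total and fixes
   what is integral, until one more edge or degree becomes integral. *)
Lemma integral_flow (c : U -> nat) x :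
    (\sum_(u in A) c u = \sum_(u in ~: A) c u)%N ->
    (forall e, 0 <= x 0 e) -> (forall u, (c u)%:R <= flow_deg x u) ->
    \sum_e x 0 e < (\sum_(u in A) c u)%:R + 1 ->
  exists g : 'I_m -> nat, forall u, (\sum_(e | incident e u) g e)%N = c u.
Proof.
move=> bal; have [n] := ubnP (#|frac_edges x| + #|frac_verts x|).
elim: n x => // n IHn x le_n x0 xc tot.
have [F0|Fn0] := eqVneq (frac_edges x) set0.
  pose g e := Num.truncn (x 0 e).
  have gE e : (g e)%:R = x 0 e.
    apply: Num.Theory.truncnK; rewrite Num.Theory.natrEint x0 andbT.
    by move/setP/(_ e): F0; rewrite !inE => /negbFE.
  have degE u : flow_deg x u = (\sum_(e | incident e u) g e)%:R.
    by rewrite natr_sum; apply: eq_bigr => e _; rewrite gE.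
  exists g => u.
  have side (B : {set U}) : (\sum_(u in A) c u = \sum_(u in B) c u)%N ->
      \sum_(u in B) flow_deg x u = \sum_e x 0 e -> u \in B ->
      (\sum_(e | incident e u) g e)%N = c u.
    move=> cB xB uB; rewrite -xB cB (eq_bigr _ (fun u _ => degE u)) in tot.
    rewrite -natr_sum natr1 ltr_nat ltnS in tot.
    have le v : v \in B -> (c v <= \sum_(e | incident e v) g e)%N.
      by move=> _; have := xc v; rewrite degE ler_nat.
    have := leqif_sum (fun v vB => leqif_eq (le v vB)).
    move=> [_]; rewrite eqn_leq (leq_sum _ le) tot => /esym/forall_inP/(_ u uB).
    by move/eqP.
  have [uA|uA] := boolP (u \in A); first exact: side (flow_deg_sumA x) uA.
  by apply: (side (~: A)); rewrite ?flow_deg_sumC ?inE.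
have [z [nz zX zY]] := frac_direction Fn0.
wlog ztot : z nz zX zY / \sum_e z 0 e <= 0 => [wl|].
  have [|ztot] := leP (\sum_e z 0 e) 0; first exact: wl.
  apply: (wl (- z)); rewrite ?oppr_eq0 //.
  - by move=> e /zX; rewrite mxE => ->; rewrite oppr0.
  - by move=> u /zY; rewrite flow_degN => ->; rewrite oppr0.
  rewrite (eq_bigr (fun e => - z 0 e)) => [|e _]; last by rewrite mxE.
  by rewrite sumrN oppr_le0 ltW.
have [e0 ze0] : exists e, z 0 e < 0.
  have [e //|zpos] := pickP (fun e => z 0 e < 0); first by exists e.
  have z0 e : 0 <= z 0 e by rewrite leNgt zpos.
  case/eqP: nz; apply/rowP=> e; rewrite mxE; apply/eqP.
  have : \sum_e z 0 e == 0 by rewrite eq_le ztot sumr_ge0.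
  by rewrite psumr_eq0 // => /allP/(_ e); rewrite mem_index_enum; apply.
(* Flows on edges and degrees at vertices obey the same rounding argument. *)
pose xi (y : 'rV[rat]_m) (i : 'I_m + U) :=
  match i with inl e => y 0 e | inr u => flow_deg y u end.
have xiD s i : xi (x + s *: z) i = xi x i + s * xi z i.
  by case: i => [e|u] /=; rewrite ?mxE // flow_degD flow_degZ.
have xi0 i : xi x i \is a Num.int -> xi z i = 0.
  case: i => [e|u] /= xint; first by apply: zX; rewrite inE negbK.
  by apply: zY; rewrite inE negbK.
have floor_xi i : 0 <= xi x i - (Num.floor (xi x i))%:~R.
  by rewrite subr_ge0 Num.Theory.real_floor_le ?num_real.
have [s s0 [sle [i0 zi0 si0]]] := @ratio_test _ _ (xi z) (inl e0) floor_xi ze0.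
have {}sle i : (Num.floor (xi x i))%:~R <= xi (x + s *: z) i.
  by rewrite xiD -subr_ge0 addrAC.
have keep i : xi x i \is a Num.int -> xi (x + s *: z) i \is a Num.int.
  by move=> xint; rewrite xiD xi0 // mulr0 addr0.
have new : xi x i0 \isn't a Num.int /\ xi (x + s *: z) i0 \is a Num.int.
  split; first by apply: contraTN zi0 => /xi0->; rewrite ltxx.
  have -> : xi (x + s *: z) i0 = (Num.floor (xi x i0))%:~R.
    by apply/eqP; rewrite xiD -subr_eq0 addrAC si0.
  by apply: Num.Theory.intr_int.
have subE : frac_edges (x + s *: z) \subset frac_edges x.
  apply/subsetP=> e; rewrite !inE; apply: contraNN; exact: (keep (inl e)).
have subV : frac_verts (x + s *: z) \subset frac_verts x.
  apply/subsetP=> u; rewrite !inE; apply: contraNN; exact: (keep (inr u)).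
apply: (IHn (x + s *: z)).
- rewrite -ltnS; apply: leq_trans le_n; rewrite ltnS.
  case: i0 new {zi0 si0} => [e|u] /= [xe x'e].
    rewrite -addSn leq_add ?subset_leq_card //; apply: proper_card.
    by apply/properP; split=> //; exists e; rewrite inE ?x'e.
  rewrite -addnS leq_add ?subset_leq_card //; apply: proper_card.
  by apply/properP; split=> //; exists u; rewrite inE ?x'e.
- move=> e; apply: le_trans (sle (inl e)).
  by rewrite ler0z Num.Theory.real_floor_ge0 ?num_real //; apply: x0.
- move=> u; apply: le_trans (sle (inr u)).
  rewrite (_ : (c u)%:R = (c u)%:Z%:~R :> rat) // ler_int.
  by rewrite Num.Theory.real_floor_ge_int ?num_real //; apply: xc.
apply: le_lt_trans tot; rewrite (eq_bigr (fun e => x 0 e + s * z 0 e)).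
  by rewrite big_split /= -mulr_sumr gerDl mulr_ge0_le0.
by move=> e _; rewrite !mxE.
Qed.


(** * Perturbed degree sequences *)

Lemma lexmin_unique t f g : lexmin t f -> lexmin t g -> f = g.
Proof.
by move=> [ff fm] [gf gm]; apply/lexv_inj/le_anti; rewrite fm // gm.
Qed.

Definition valence u : nat := #|[set e | incident e u]|.

(** Small enough for the perturbation to total less than one, so that an integral
   flow with the original degrees can be recovered by rounding. *)
Definition eps : rat := m.+1%:R^-1.

Definition perturbed (c : U -> nat) u : rat := (c u)%:R + eps * (valence u)%:R.

Definition is_degree_seq (c : U -> nat) : Prop :=
  exists g : 'I_m -> nat, forall u, (\sum_(e | incident e u) g e)%N = c u.

Definition pendant e : bool := valence (src e) == 1%N.

Lemma eps_gt0 : 0 < eps. Proof. by rewrite invr_gt0 ltr0n. Qed.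

Lemma eps_lt1 : eps * m%:R < 1.
Proof. by rewrite mulrC ltr_pdivrMr ?ltr0n // mul1r ltr_nat. Qed.

Lemma flow_deg_const a u : flow_deg (const_mx a) u = a * (valence u)%:R.
Proof.
rewrite /flow_deg (eq_bigr (fun=> a)) => [|e _]; last by rewrite mxE.
by rewrite sumr_const mulr_natr /valence cardsE.
Qed.

Lemma perturbedD (c c' : U -> nat) e :
    (forall u, c' u = (incident e u + c u)%N) ->
  forall u, perturbed c' u = perturbed c u + (incident e u)%:R.
Proof. by move=> cE u; rewrite /perturbed cE natrD; ring. Qed.

Lemma perturbed_feasible c : is_degree_seq c -> exists f, feasible (perturbed c) f.
Proof.
move=> [g gc]; exists (const_mx eps + \row_e (g e)%:R); split=> [e|u].
  by rewrite !mxE addr_ge0 ?ler0n // ltW ?eps_gt0.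
rewrite flow_degD flow_deg_const addrC /perturbed -gc natr_sum.
by congr (_ + _); apply: eq_bigr => e _; rewrite mxE.
Qed.

Lemma perturbed_degree_seq c f : feasible (perturbed c) f -> is_degree_seq c.
Proof.
move=> [f0 fc].
have tot (B : {set U}) : (forall x, \sum_(u in B) flow_deg x u = \sum_e x 0 e) ->
    \sum_e f 0 e = (\sum_(u in B) c u)%:R + eps * m%:R.
  move=> sumB; rewrite -sumB (eq_bigr _ (fun u _ => fc u)) big_split /= natr_sum.
  congr (_ + _); have := sumB (const_mx eps).
  rewrite (eq_bigr _ (fun u _ => flow_deg_const eps u)).
  move=> ->; rewrite (eq_bigr (fun=> eps)) => [|e _]; last by rewrite mxE.
  by rewrite sumr_const card_ord mulr_natr.
have totA := tot _ flow_deg_sumA.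
apply: (integral_flow (x := f)) => //.
- apply/eqP; rewrite -(eqr_nat rat); apply/eqP.
  by apply: (addIr (eps * m%:R)); rewrite -totA -(tot _ flow_deg_sumC).
- by move=> u; rewrite fc lerDl mulr_ge0 ?ler0n // ltW ?eps_gt0.
by rewrite totA ltrD2l eps_lt1.
Qed.

Lemma incidentC e u : u \notin A -> incident e u = (tgt e == u).
Proof.
move=> uA; rewrite /incident eq_sym; case: eqP => /= [su|_]; last exact: eq_sym.
by rewrite -su srcA in uA.
Qed.

(** If the flow on every edge is at most one, the pendant edges carry [eps]
   each, so the other edges at a vertex [u] outside [A] carry more than [c u]
   in total and there are more than [c u] of them in the support. *)
Lemma support_count c f : feasible (perturbed c) f -> (forall e, f 0 e <= 1) ->
    (forall u, u \notin A -> exists2 e, tgt e = u & ~~ pendant e) ->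
  (\sum_(u in ~: A) (c u).+1 + #|[set e | pendant e]| <= #|support f|)%N.
Proof.
move=> [f0 fc] f1 nonpend.
have fpend e : pendant e -> f 0 e = eps.
  move=> /cards1P[e' E].
  have inc i : incident i (src e) = (i == e').
    by have := in_set (fun i => incident i (src e)) i; rewrite E in_set1.
  have ee' : e' = e by apply/esym/eqP; rewrite -inc /incident eqxx.
  have := fc (src e); rewrite /flow_deg (eq_bigl _ _ inc) big_pred1_eq ee'.
  rewrite /perturbed /valence E cards1 mulr1 => fE.
  have : (c (src e))%:R < 1 :> rat.
    by apply: lt_le_trans (f1 e); rewrite fE ltrDl eps_gt0.
  by rewrite (ltr_nat _ _ 1) ltnS leqn0 fE => /eqP->; rewrite add0r.
pose other u := [set e | (tgt e == u) && ~~ pendant e].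
have other_big u : u \in ~: A -> (c u < #|[set e in support f | e \in other u]|)%N.
  rewrite inE => uA; rewrite -(ltr_nat rat).
  have [e0 te0 pe0] := nonpend u uA.
  have sum_other : \sum_(e in other u) f 0 e = (c u)%:R + eps * #|other u|%:R.
    pose pend := [set e | (tgt e == u) && pendant e].
    have sum_pend : \sum_(e in pend) f 0 e = eps * #|pend|%:R.
      rewrite (eq_bigr (fun=> eps)) ?sumr_const ?mulr_natr // => e.
      by rewrite inE => /andP[_ /fpend].
    have -> : \sum_(e in other u) f 0 e = flow_deg f u - \sum_(e in pend) f 0 e.
      rewrite /flow_deg [X in X - _](bigID pendant) /= [X in X - _]addrC; apply/esym.
      rewrite (eq_bigl (fun e => e \in other u)) => [|e]; last by rewrite !inE incidentC.
      rewrite [X in _ + X - _](eq_bigl (fun e => e \in pend)) ?addrK // => e.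
      by rewrite !inE incidentC.
    have -> : #|other u|%:R = (valence u)%:R - #|pend|%:R :> rat.
      apply/eqP; rewrite eq_sym subr_eq -natrD eqr_nat addnC; apply/eqP.
      rewrite /valence -(cardsID [set e | pendant e] [set e | incident e u]).
      congr (_ + _)%N; apply: eq_card => e; rewrite !inE incidentC //.
      by rewrite andbC.
    by rewrite fc sum_pend /perturbed; ring.
  have : (c u)%:R < \sum_(e in other u) f 0 e.
    rewrite sum_other ltrDl mulr_gt0 ?eps_gt0 // ltr0n; apply/card_gt0P.
    by exists e0; rewrite inE te0 eqxx.
  move=> lt; apply: lt_le_trans lt _.
  rewrite -sum1_card natr_sum (bigID (mem (support f))) /= [X in _ + X]big1.
    rewrite addr0 [leRHS](eq_bigl (fun e => (e \in other u) && (e \in support f))).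
      by apply: ler_sum.
    by move=> e; rewrite !inE andbC.
  by move=> e /andP[_]; rewrite inE negbK => /eqP.
have -> : #|support f| = (\sum_(u in ~: A) #|[set e in support f | e \in other u]|
    + #|[set e | pendant e]|)%N.
  rewrite -(cardsID [set e | pendant e] (support f)) addnC; congr (_ + _)%N.
    under [RHS]eq_bigr => u _ do rewrite -sum1dep_card.
    rewrite (exchange_big_dep (fun e => e \in support f :\: [set e | pendant e])).
      rewrite -sum1_card; apply: eq_bigr => e; rewrite !inE => /andP[pe fe].
      rewrite (bigD1 (tgt e)) /= ?inE ?tgtA ?eqxx ?fe ?pe // big1 // => u.
      by rewrite !inE eq_sym => /andP[/and3P[_ _ /andP[/eqP-> _]]]; rewrite eqxx.
    by move=> u e _; rewrite !inE => /and3P[-> _ ->].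
  apply: eq_card => e; rewrite !inE; case: (boolP (pendant e)) => [/fpend->|].
    by rewrite gt_eqF ?eps_gt0.
  by rewrite andbF.
by rewrite leq_add2r; apply: leq_sum.
Qed.

Lemma large_edge c f : feasible (perturbed c) f -> forest_supported f ->
    (exists u, u \in A) ->
    (forall u, u \notin A -> exists2 e, tgt e = u & ~~ pendant e) ->
    (#|A| <= \sum_(u in ~: A) c u + #|[set e | pendant e]|)%N ->
  exists e, 1 < f 0 e.
Proof.
move=> feas free [u0 _] nonpend big_c.
have [e fe|small] := pickP (fun e => 1 < f 0 e); first by exists e.
have f1 e : f 0 e <= 1 by rewrite leNgt small.
have := leq_ltn_trans (support_count feas f1 nonpend) (card_forest u0 free).
under eq_bigr => u _ do rewrite -addn1.
rewrite big_split /= sum1_card -(cardsC A).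
by rewrite addnAC ltn_add2r ltnNge big_c.
Qed.

End Flows.

(** * Divisor complexes of a bipartite graph *)

Section BipartiteDivisors.
Variables (k : fieldType) (l m : nat) (src tgt : 'I_m -> 'I_l).
Variable A : {set 'I_l}.
Hypothesis srcA : forall e, src e \in A.
Hypothesis tgtA : forall e, tgt e \notin A.
Hypothesis nonpendant : forall u, u \notin A ->
  exists2 e, tgt e = u & ~~ pendant src tgt e.
Hypothesis A_nonempty : exists u, u \in A.
Variable mon : 'I_m -> 'X_{1..l}.
Hypothesis monE : forall e u, mon e u = incident src tgt e u.
Variable Q : pred 'X_{1..l}.
Hypothesis QP : forall c : 'X_{1..l}, reflect (is_degree_seq src tgt c) (Q c).
Implicit Types (e : 'I_m) (F : {set 'I_m}) (b c : 'X_{1..l}).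

Lemma degree_seq_mul e c : Q c -> Q (mon e + c)%MM.
Proof.
move=> /QP[g gc]; apply/QP; exists (fun i => (i == e) + g i)%N => u.
rewrite big_split /= gc mnmDE monE; congr (_ + _)%N.
have [inc|inc] := boolP (incident src tgt e u).
  by rewrite (bigD1 e) //= eqxx big1 // => i /andP[_ /negPf->].
by rewrite big1 // => i; case: eqP => // ->; rewrite (negPf inc).
Qed.

(** Meaningful when [Q c] holds, in which case such a flow exists. *)
Definition best_flow c : 'rV[rat]_m :=
  epsilon (inhabits 0) (lexmin src tgt (perturbed src tgt c)).

Lemma best_flowP c : Q c -> lexmin src tgt (perturbed src tgt c) (best_flow c).
Proof.
move=> /QP/perturbed_feasible[f /(lexmin_exists srcA tgtA) ex].
exact: epsilon_spec ex.
Qed.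

Definition indicator F : 'rV[rat]_m := \row_e (e \in F)%:R.

Lemma indicatorU e F : e \notin F ->
  indicator (e |: F) = indicator F + delta_mx 0 e.
Proof.
move=> eF; apply/rowP=> i; rewrite !mxE !inE eqxx /=.
by case: eqVneq => [->|_] /=; rewrite ?(negPf eF) ?add0r ?addr0.
Qed.

(** The value of a face [F] of the divisor complex of [b] is the flow that
   represents it: the best flow for the remaining degrees [b - mon_sum F]
   together with one unit on each edge of [F].  An edge with value above one can
   be moved in and out of [F], as it carries positive flow before and after the
   move. *)
Lemma divisor_acyclic b (p : nat) :
    (p + #|A| <= \sum_(u in ~: A) b u + #|[set e | pendant src tgt e]|)%N ->
  acyclic_at k (divisor_complex mon Q b) p.
Proof.
move=> big_b.
pose rest F := (b - mon_sum mon F)%MM.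
pose flow F := best_flow (rest F) + indicator F.
have flowP F : divisor_complex mon Q b F ->
    lexmin src tgt (perturbed src tgt (rest F)) (best_flow (rest F)).
  by move=> /andP[_]; apply: best_flowP.
have restU e F : e \notin F -> divisor_complex mon Q b (e |: F) ->
    rest F = (mon e + rest (e |: F))%MM.
  move=> eF /andP[]; rewrite /rest mon_sumU // => /mnm_lepP le _.
  by apply/mnmP=> u; have := le u; rewrite !(mnmDE, mnmBE); lia.
have perturbed_mon e c u : perturbed src tgt (mon e + c)%MM u =
    perturbed src tgt c u + (incident src tgt e u)%:R.
  by apply: perturbedD => v; rewrite mnmDE monE.
have flow_add e c : Q c -> 0 < best_flow c 0 e ->
    best_flow (mon e + c)%MM = best_flow c + delta_mx 0 e.
  move=> Qc fe; apply: lexmin_unique (best_flowP (degree_seq_mul e Qc)) _.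
  by apply: (lexmin_add srcA tgtA (best_flowP Qc) fe) => u.
have flow_sub e c : Q (mon e + c)%MM -> 1 <= best_flow (mon e + c)%MM 0 e ->
    Q c /\ best_flow (mon e + c)%MM = best_flow c + delta_mx 0 e.
  move=> Qec fe; have lm := lexmin_sub (best_flowP Qec) fe (perturbed_mon e c).
  have Qc : Q c by apply/QP; exact: perturbed_degree_seq (proj1 lm).
  by split=> //; rewrite (lexmin_unique (best_flowP Qc) lm) subrK.
(* The perturbed degrees at a vertex where [c] vanishes are below one. *)
have mon_le e c : Q c -> 1 < best_flow c 0 e -> (mon e <= c)%MM.
  move=> /best_flowP[[f0 fc] _] fe; apply/mnm_lepP=> u; rewrite monE.
  case: (boolP (incident src tgt e u)) => // inc; rewrite lt0n.
  apply: contraTneq fe => cu0; rewrite -leNgt; apply: ltW.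
  apply: le_lt_trans (eps_lt1 m).
  apply: (le_trans (y := eps m * (valence src tgt u)%:R)).
    have := fc u; rewrite /perturbed cu0 add0r => <-.
    rewrite /flow_deg (bigD1 e) //= lerDl sumr_ge0 //.
  apply: ler_wpM2l; first exact: ltW (eps_gt0 m).
  rewrite ler_nat.
  by rewrite -[leqRHS]card_ord max_card.
apply: (@acyclic_of_toggle _ _ _ _ _ _ (fun F => lexv (flow F))
  (fun v e => 1 < tnth v e)).
- by move=> e F; apply: divisor_complex_down; apply: degree_seq_mul.
- move=> e F eF DeF; have [feas _] := flowP _ DeF.
  have DF := divisor_complex_down degree_seq_mul DeF.
  have Qc : Q (rest (e |: F)) by case/andP: DeF.
  rewrite /flow (restU _ _ eF DeF) indicatorU // [_ + delta_mx 0 e]addrC addrA.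
  apply: lexv_le_add; apply: (proj2 (best_flowP (degree_seq_mul e Qc))).
  have [f0 fc] := feas; split=> [i|u].
    by rewrite !mxE addr_ge0 // ler0n.
  by rewrite flow_degD flow_deg_delta // fc perturbed_mon.
- move=> e F DF; rewrite tnth_mktuple !mxE.
  have [eF|eF] := boolP (e \in F) => fe.
    have eF' : e \notin F :\ e by rewrite !inE eqxx.
    have FE : e |: (F :\ e) = F by rewrite setD1K.
    have DeF : divisor_complex mon Q b (e |: (F :\ e)) by rewrite FE.
    rewrite (setUidPr _) ?sub1set //; split=> //.
    rewrite /flow (restU _ _ eF' DeF) FE flow_add.
    - by have := indicatorU eF'; rewrite FE => ->; rewrite addrA addrAC.
    - by case/andP: DF.
    by move: fe; rewrite mulr1n ltrDr.
  rewrite addr0 in fe; have [le_b Qc] := andP DF.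
  have le_c := mon_le _ _ Qc fe; pose c' := (rest F - mon e)%MM.
  have cE : rest F = (mon e + c')%MM by rewrite addmC submK.
  have [||Qc' flowE] := flow_sub e c'; rewrite -?cE // ?ltW //.
  have restE : rest (e |: F) = c'.
    rewrite /c' /rest mon_sumU //; apply/mnmP=> u; rewrite !(mnmBE, mnmDE).
    by rewrite addnC subnDA.
  have -> : F :\ e = F by apply/setDidPl; rewrite disjoint_sym disjoints1.
  split=> //.
    rewrite /divisor_complex -/(rest _) restE Qc' andbT mon_sumU //.
    apply/mnm_lepP=> u; have /mnm_lepP/(_ u) := le_c; have /mnm_lepP/(_ u) := le_b.
    by rewrite mnmDE mnmBE; lia.
  by rewrite /flow restE cE flowE indicatorU // addrA addrAC.
move=> F DF cF; have [le_b Qc] := andP DF.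
have lm := flowP F DF.
have [|e fe] := large_edge srcA tgtA (proj1 lm) (lexmin_forest srcA tgtA lm)
  A_nonempty nonpendant.
  move: big_b; have -> : (\sum_(u in ~: A) b u = p + \sum_(u in ~: A) rest F u)%N.
    rewrite -cF -sum1_card.
    rewrite (eq_bigr (fun u => mon_sum mon F u + rest F u)%N) => [|u _].
      rewrite big_split /=; congr (_ + _)%N.
      under eq_bigr => u _ do rewrite mnm_sumE.
      rewrite exchange_big; apply: eq_bigr => e _ /=.
      rewrite (bigD1 (tgt e)) /= ?inE ?tgtA // monE /incident eqxx orbT.
      rewrite big1 // => u /andP[+ ne]; rewrite inE => uA.
      by rewrite monE (@incidentC _ _ src tgt A) // eq_sym (negPf ne).
    by have /mnm_lepP/(_ u) := le_b; rewrite mnmBE; lia.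
  by rewrite -addnA leq_add2l.
exists e; rewrite tnth_mktuple !mxE; apply: lt_le_trans fe _.
by rewrite lerDl ler0n.
Qed.

End BipartiteDivisors.

(** * Toric edge rings of bipartite graphs *)

Lemma mpolyX_sum (k : fieldType) (l : nat) (T : Type) (r : seq T) (P : pred T)
    (F : T -> 'X_{1..l}) :
  'X_[\sum_(i <- r | P i) F i] = \prod_(i <- r | P i) 'X_[F i] :> {mpoly k[l]}.
Proof. exact: (big_morph _ (@mpolyXD _ _) (@mpolyX0 _ _)). Qed.

Section ToricEdgeRing.
Variables (k : fieldType) (B : sgraph) (V W : {set B}).
Hypothesis VW_bip : bipartition V W.
Local Notation m := #|edges B|.
Local Notation l := #|B|.
Implicit Types (e : 'I_m) (u v w : B).

Lemma bipartition_notin u : (u \notin V) = (u \in W).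
Proof.
have [cover disj _] := VW_bip; have := in_setT u; rewrite -cover inE.
have [uV _|_ /= ->//] := boolP (u \in V).
by rewrite (disjointFr disj uV).
Qed.

Lemma edge_ends : exists vw : 'I_m -> B * B, forall e,
  [/\ adj (vw e).1 (vw e).2, (vw e).1 \in V, (vw e).2 \notin V
    & enum_val e = [set (vw e).1; (vw e).2]].
Proof.
apply: (@fin_all_exists _ _ (fun e (p : B * B) =>
  [/\ adj p.1 p.2, p.1 \in V, p.2 \notin V & enum_val e = [set p.1; p.2]])) => e.
have /imsetP[[u v] /= uv ->] := enum_valP e; rewrite inE /= in uv.
have [_ _ side] := VW_bip; have uVE := side _ _ uv.
have [uV|uV] := boolP (u \in V).
  exists (u, v); split=> //=; rewrite bipartition_notin -uVE //.
exists (v, u); split=> //=; first by rewrite adj_sym.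
  by rewrite -[v \in V]negbK bipartition_notin -uVE.
by rewrite setUC.
Qed.

Variable vw : 'I_m -> B * B.
Hypothesis vwP : forall e,
  [/\ adj (vw e).1 (vw e).2, (vw e).1 \in V, (vw e).2 \notin V
    & enum_val e = [set (vw e).1; (vw e).2]].

Let src e : 'I_l := enum_rank (vw e).1.
Let tgt e : 'I_l := enum_rank (vw e).2.
Let A : {set 'I_l} := [set i | enum_val i \in V].
Let mon e : 'X_{1..l} := (\sum_(v in enum_val e) U_(enum_rank v))%MM.

Lemma incident_edge e u : incident src tgt e (enum_rank u) = (u \in enum_val e).
Proof.
have [_ _ _ ->] := vwP e.
by rewrite /incident /src /tgt !(inj_eq enum_rank_inj) !inE.
Qed.

Lemma srcA e : src e \in A.
Proof. by have [_ vV _ _] := vwP e; rewrite inE enum_rankK. Qed.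

Lemma tgtA e : tgt e \notin A.
Proof. by have [_ _ wV _] := vwP e; rewrite inE enum_rankK. Qed.

Lemma card_side : #|A| = #|V|.
Proof.
rewrite -(card_imset _ enum_val_inj); apply: eq_card => u.
apply/imsetP/idP => [[i iA ->]|uV]; first by rewrite inE in iA.
by exists (enum_rank u); rewrite ?inE enum_rankK.
Qed.

Lemma monE e i : mon e i = incident src tgt e i.
Proof.
rewrite /mon mnm_sumE -[i]enum_valK incident_edge.
under eq_bigr => v _ do rewrite mnm1E (inj_eq enum_rank_inj).
have [iv|iv] := boolP (_ \in _).
  by rewrite (bigD1 (enum_val i)) //= eqxx big1 // => v /andP[_ /negPf->].
by rewrite big1 // => v ve; case: eqP => // vi; rewrite vi (negPf iv) in ve.
Qed.

Lemma valence_degree u : valence src tgt (enum_rank u) = degree u.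
Proof.
rewrite /valence /degree -(card_imset _ enum_val_inj).
have adj_ne v : adj u v -> v != u.
  by apply: contraTneq => ->; rewrite adj_irr.
rewrite -(@card_in_imset _ _ (fun v => [set u; v])) => [|v v']; last first.
  rewrite !inE => /adj_ne nv _ E; have : v \in [set u; v'] by rewrite -E set22.
  by rewrite !inE (negPf nv) => /eqP.
apply: eq_card => S; apply/imsetP/imsetP => [[e]|[v]]; rewrite inE.
  rewrite incident_edge => ue ->; have [vw_adj _ _ eE] := vwP e.
  move: ue; rewrite eE !inE => /orP[/eqP->|/eqP->].
    by exists (vw e).2; rewrite ?inE.
  by exists (vw e).1; rewrite 1?setUC ?inE 1?adj_sym.
move=> uv ->; have Se : [set u; v] \in edges B.
  by apply/imsetP; exists (u, v); rewrite ?inE.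
exists (enum_rank_in Se [set u; v]); last by rewrite enum_rankK_in.
by rewrite inE incident_edge enum_rankK_in // set21.
Qed.

Lemma card_leaves_pendant : (#|leaves V| <= #|[set e | pendant src tgt e]|)%N.
Proof.
apply: leq_trans (leq_imset_card (fun e => (vw e).1) _).
apply: subset_leq_card; apply/subsetP=> v; rewrite inE => /andP[vV deg1].
have /card_gt0P[e] : (0 < #|[set e | incident src tgt e (enum_rank v)]|)%N.
  by rewrite -/(valence _ _ _) valence_degree (eqP deg1).
have [_ _ wV eE] := vwP e; rewrite inE incident_edge eE !inE => ve.
have vE : v = (vw e).1.
  by case/orP: ve => /eqP // vw2; rewrite -vw2 vV in wV.
by apply/imsetP; exists e; rewrite // inE /pendant /src -vE valence_degree.
Qed.

(** A vertex all of whose neighbours are leaves forms, with them, a connected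
   component. *)
Lemma nonpendant_edge (B_conn : connected_graph B) (W2 : (1 < #|W|)%N) i :
  i \notin A -> exists2 e, tgt e = i & ~~ pendant src tgt e.
Proof.
rewrite inE => iV; pose w := enum_val i; have wV : w \notin V := iV.
have wW : w \in W by rewrite -bipartition_notin.
have [v /andP[wv dv]|star] := pickP (fun v => adj w v && (degree v != 1%N)).
  have vV : v \in V by have [_ _ side] := VW_bip; rewrite (side _ w) // adj_sym.
  have Se : [set w; v] \in edges B by apply/imsetP; exists (w, v); rewrite ?inE.
  have [_ sV tV] := vwP (enum_rank_in Se [set w; v]).
  set e := enum_rank_in _ _ in sV tV *; rewrite enum_rankK_in // => E.
  have tE : (vw e).2 = w.
    have : (vw e).2 \in [set w; v] by rewrite E set22.
    by rewrite !inE => /orP[/eqP|/eqP tv] //; rewrite tv vV in tV.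
  have sE : (vw e).1 = v.
    have : (vw e).1 \in [set w; v] by rewrite E set21.
    by rewrite !inE => /orP[/eqP sw|/eqP] //; rewrite sw (negPf wV) in sV.
  exists e; first by rewrite /tgt tE enum_valK.
  by rewrite /pendant /src sE valence_degree.
pose X := [set v | (v == w) || adj w v].
have Xclosed : closed (@adj B) (mem X).
  apply: intro_closed; first exact: sym_connect_sym (@adj_sym B).
  move=> u v uv; rewrite !inE => /orP[/eqP uw|wu].
    by rewrite -uw uv orbT.
  have /cards1P[x Ex] : degree u == 1%N.
    by have := star u; rewrite wu => /negbFE.
  have : v \in [set x] by rewrite -Ex inE.
  have : w \in [set x] by rewrite -Ex inE adj_sym.
  by rewrite !inE => /eqP-> /eqP->; rewrite eqxx.
have /card_gt0P[w'] : (0 < #|W :\ w|)%N.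
  by have := cardsD1 w W; rewrite wW; lia.
rewrite !inE => /andP[ne w'W].
have := closed_connect Xclosed (B_conn w w'); rewrite !inE eqxx /=.
move=> /esym/orP[/eqP w'w|ww']; first by rewrite w'w eqxx in ne.
have [_ _ side] := VW_bip; have := side _ _ ww'.
by rewrite w'W (negPf wV).
Qed.

Lemma edge_monomialE e : edge_monomial k (enum_val e) = 'X_[mon e].
Proof. by rewrite /mon mpolyX_sum. Qed.

Let monomials : m.-tuple {mpoly k[l]} :=
  [tuple edge_monomial k (enum_val e) | e < m].

Lemma toric_mapE (p : {mpoly k[m]}) : toric_map p = p \mPo monomials.
Proof. by []. Qed.

Lemma toric_monomial (mu : 'X_{1..m}) :
  toric_map ('X_[mu] : {mpoly k[m]}) = 'X_[\sum_e mon e *+ mu e].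
Proof.
rewrite toric_mapE comp_mpolyX mpolyX_sum; apply: eq_bigr => e _.
by rewrite tnth_mktuple edge_monomialE mpolyXn.
Qed.

Lemma toric_degree (mu : 'X_{1..m}) i :
  (\sum_e mon e *+ mu e)%MM i = (\sum_(e | incident src tgt e i) mu e)%N.
Proof.
rewrite mnm_sumE [RHS]big_mkcond; apply: eq_bigr => e _.
by rewrite mulmnE monE; case: incident; rewrite ?mul1n ?mul0n.
Qed.

Definition toric_degree_seq (c : 'X_{1..l}) : bool :=
  if excluded_middle_informative (is_degree_seq src tgt c) then true else false.

Lemma toric_degree_seqP (c : 'X_{1..l}) :
  reflect (is_degree_seq src tgt c) (toric_degree_seq c).
Proof.
by rewrite /toric_degree_seq; case: excluded_middle_informative => ?; constructor.
Qed.

Lemma degree_total (mu : 'X_{1..m}) :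
  (\sum_(i in ~: A) (\sum_e mon e *+ mu e)%MM i = mdeg mu)%N.
Proof.
under eq_bigr => i _ do rewrite toric_degree.
rewrite (exchange_big_dep predT) //= mdegE; apply: eq_bigr => e _.
rewrite (bigD1 (tgt e)) /= ?inE ?enum_rankK; last first.
  by have [_ _ -> _] := vwP e; rewrite /incident eqxx orbT.
rewrite big1 ?addn0 // => i /andP[/andP[iA inc] ne]; rewrite in_setC in iA.
by move: ne; rewrite -(eqP (etrans (esym (@incidentC _ _ src tgt A srcA e i iA)) inc)) eqxx.
Qed.

Lemma toric_msupp (p : {mpoly k[m]}) c : c \in msupp (toric_map p) ->
  exists2 mu, mu \in msupp p & c = (\sum_e mon e *+ mu e)%MM.
Proof.
rewrite toric_mapE {1}[p]mpolyE raddf_sum /= => /msupp_sum_le /flatten_mapP[mu].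
rewrite mem_filter /= => mu_p; rewrite comp_mpolyZ -toric_mapE toric_monomial.
by move=> /msuppZ_le; rewrite msuppX inE => /eqP; exists mu.
Qed.

Lemma toric_lift (p : {mpoly k[l]}) : {subset msupp p <= toric_degree_seq} ->
  exists w : {mpoly k[m]}, toric_map w = p.
Proof.
move=> pQ; rewrite [p]mpolyE big_seq.
elim/big_rec: _ => [|c q /pQ/toric_degree_seqP[g gc] [w <-]].
  by exists 0; rewrite toric_mapE raddf0.
exists (p@_c *: 'X_[[multinom g e | e < m]] + w).
rewrite !toric_mapE raddfD /= comp_mpolyZ -toric_mapE toric_monomial.
congr (_ *: 'X_[_] + _); apply/mnmP=> i; rewrite toric_degree -gc.
by apply: eq_bigr => e _; rewrite mnmE.
Qed.

Lemma toric_koszul_bd (z : {set 'I_m} -> {mpoly k[m]}^o) F :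
  toric_map (koszul_bd (koszul_var k (fun e => U_(e)%MM)) z F) =
    koszul_bd (koszul_var k mon) (fun F' => toric_map (z F') : {mpoly k[l]}^o) F.
Proof.
rewrite toric_mapE raddf_sum; apply: eq_bigr => e _ /=.
rewrite !rmorphM rmorph_sign /=; congr (_ * _ * _).
by rewrite /koszul_var comp_mpolyXU -tnth_nth tnth_mktuple edge_monomialE.
Qed.

Hypothesis B_conn : connected_graph B.
Hypothesis V_gt0 : (0 < #|V|)%N.
Hypothesis W_gt1 : (1 < #|W|)%N.

(** The total degree over [W] of a monomial of the edge ring is its degree as an
   element of that ring, which is what the divisor complexes are sensitive to. *)
Lemma toric_koszul_vanish (i rho : nat) : (#|V| <= rho + #|leaves V|)%N ->
  koszul_vanish (toric_edge_ideal k B) i rho.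
Proof.
move=> big_rho z zhom zI.
pose t F : {mpoly k[l]}^o := toric_map (z F).
have tsupp F c : c \in msupp (t F) ->
    [/\ #|F| = i, toric_degree_seq c & (\sum_(j in ~: A) c j = rho)%N].
  move=> /toric_msupp[mu /zhom[cF dmu] ->]; split=> //.
    by apply/toric_degree_seqP; exists mu => j; rewrite toric_degree.
  by rewrite degree_total.
have [F c /tsupp[]//|F|F c /tsupp[cF _ dc]|y yQ tE] :=
  @koszul_exact_of_strands k l m mon toric_degree_seq t i.
- by rewrite -toric_koszul_bd; apply/eqP; apply: zI.
- apply: (divisor_acyclic (A := A) srcA tgtA (nonpendant_edge B_conn W_gt1) _ monE
    toric_degree_seqP).
    have /card_gt0P[v vV] := V_gt0.
    by exists (enum_rank v); rewrite inE enum_rankK.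
  under eq_bigr => j _ do rewrite mnmDE.
  rewrite big_split /= dc card_side.
  have -> : (\sum_(j in ~: A) mon_sum mon F j = i)%N.
    rewrite -cF -[RHS]sum1_card.
    pose mu := [multinom (e \in F : nat) | e < m].
    rewrite (_ : mon_sum mon F = (\sum_e mon e *+ mu e)%MM).
      rewrite degree_total mdegE [RHS]big_mkcond.
      by apply: eq_bigr => e _; rewrite mnmE; case: (e \in F).
    rewrite /mon_sum big_mkcond; apply: eq_bigr => e _.
    by rewrite mnmE; case: (e \in F).
  rewrite addnAC addnC leq_add2r; apply: leq_trans big_rho _.
  by rewrite leq_add2l card_leaves_pendant.
have lift F : exists w : {mpoly k[m]}, toric_map w = y F.
  by apply: toric_lift => c /yQ[].
have [w wE] := fin_all_exists lift.
exists w => F; apply/eqP.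
rewrite toric_mapE raddfB /= -!toric_mapE toric_koszul_bd -/(t F) tE.
by apply/eqP; rewrite subr_eq0; apply/eqP; apply: eq_bigr => e _; rewrite wE.
Qed.

End ToricEdgeRing.

Lemma regularity_lt_side (k : fieldType) (B : sgraph) (V W : {set B}) (rho : nat) :
    connected_graph B -> bipartition V W -> (0 < #|V|)%N -> (1 < #|W|)%N ->
    is_regularity (toric_edge_ideal k B) rho ->
  (rho + #|leaves V| < #|V|)%N.
Proof.
move=> B_conn VW_bip V0 W1 [F [Fres [i]]].
rewrite -lt0n => /card_gt0P[a]; rewrite inE => /eqP deg_a _.
rewrite ltnNge; apply/negP=> big_rho.
have [vw vwP] := edge_ends VW_bip.
apply: (@no_generator k _ (toric_edge_ideal k B) F _ _ Fres i rho a _ deg_a).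
- by move=> p q /eqP p0 /eqP q0; apply/eqP; rewrite toric_mapE raddfB /= -!toric_mapE p0 q0 subrr.
- by move=> p q /eqP q0; apply/eqP; rewrite toric_mapE rmorphM /= -!toric_mapE q0 mulr0.
by apply: (toric_koszul_vanish VW_bip vwP).
Qed.

Local Close Scope ring_scope.

Theorem theorem6p13 (k : fieldType) (B : sgraph) (V W : {set B})
    (n d r s rho : nat)
    (B_connected : connected_graph B) (VW_bipartition : bipartition V W)
    (card_V : #|V| = n) (card_W : #|W| = d)
    (n_ge2 : 2 <= n) (d_ge2 : 2 <= d)
    (r_def : r = #|leaves V|) (s_def : s = #|leaves W|)
    (rho_reg : is_regularity (toric_edge_ideal k B) rho) :
  rho <= minn (n - r) (d - s) - 1.
Proof.
have swap : bipartition W V.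
  have [cover disj side] := VW_bipartition; split; first by rewrite setUC.
    by rewrite disjoint_sym.
  by move=> u v uv; rewrite (side v u) // adj_sym.
have := regularity_lt_side B_connected VW_bipartition _ _ rho_reg.
have := regularity_lt_side B_connected swap _ _ rho_reg.
rewrite -r_def -s_def card_V card_W => ltW ltV.
by have := ltW ltac:(lia) ltac:(lia); have := ltV ltac:(lia) ltac:(lia); lia.
Qed.
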